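(* Let $T>0$ and let $\lambda,\mu\in C^1(-\infty,T)$ be real-valued functions such that there are no $a_1,a_2\in\mathbb R$ with $(\lambda(t),\mu(t))=\left(a_1(T-t)^{-\frac27},\,a_2(T-t)^{-\frac37}\right)$ for all $t$. Then there is no solution $B$ of $$B_t+\nabla\times((\nabla\times B)\times B)=0,\qquad \nabla\cdot B=0\quad\text{in }\mathbb R^3$$ of the pseudo-self-similar form $$B(x,t)=\mu(t)\,H(\lambda(t)x)$$ for a profile vector field $H:\mathbb R^3\to\mathbb R^3$, which is regular on $[0,T)$ and satisfies $$\operatorname*{ess\,sup}_{0<t<T}\|B(t)\|_{L^2(\mathbb R^3)}<\infty$$ and $$\lim_{t\to T^-}\int_0^t\|\nabla^2B(\tau)\|_{L^\infty}\,d\tau=\infty.$$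
   Context: The system is the electron MHD system with zero resistivity. ''Regular on $[0,T)$'' means that $B$ is a (sufficiently smooth) classical solution on $\mathbb R^3\times[0,T)$. For such a pseudo-self-similar solution, $\lambda$, $\mu$ and $H$ satisfy $$\frac{\mu'}{\lambda^2\mu^2}H+\frac{\lambda'}{\lambda^3\mu}\,y\cdot\nabla H+\nabla\times((\nabla\times H)\times H)=0,\qquad y=\lambda(t)x.$$
   Formalization: The integral of ‖∇²B‖_{L^∞} over [0,t] is also required to be finite for each t<T (otherwise steady solutions with unbounded ∇²B are counterexamples); ''for all t'' and the form of B refer to one common time interval between [0,T) and (-∞,T). *)

(* Defs.v *)
From HB Require Import structures.
From mathcomp Require Import all_boot all_order all_algebra.
From mathcomp Require Import all_classical all_reals all_analysis.
From mathcomp Require Import ess_sup_inf.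

Set Implicit Arguments.
Unset Strict Implicit.
Unset Printing Implicit Defensive.

Import Order.TTheory GRing.Theory Num.Theory.
Import numFieldNormedType.Exports.

Local Open Scope classical_set_scope.
Local Open Scope ring_scope.

(* [D] is meant to be open, so that two-sided derivatives are the right ones. *)
Definition C1_on (R : realType) (D : set R) (f : R -> R) : Prop :=
  (forall t, D t -> derivable f t 1) /\ {within D, continuous (derive1 f)}.

Section VectorCalculus.
Context {R : realType}.
Implicit Types (f : 'rV[R]_3 -> 'rV[R]_3) (x : 'rV[R]_3).

Definition coord f (k : 'I_3) : 'rV[R]_3 -> R := fun x => f x 0 k.

Definition pd (i : 'I_3) (g : 'rV[R]_3 -> R) : 'rV[R]_3 -> R :=
  fun x => 'D_(delta_mx 0 i) g x.

(* In [crossv] and [curl] indices are added in 'I_3 = Z/3Z, i.e. cyclically. *)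
Definition crossv (u v : 'rV[R]_3) : 'rV[R]_3 :=
  \row_k (u 0 (k + 1) * v 0 (k + 2) - u 0 (k + 2) * v 0 (k + 1)).

Definition curl f : 'rV[R]_3 -> 'rV[R]_3 :=
  fun x => \row_k (pd (k + 1) (coord f (k + 2)) x - pd (k + 2) (coord f (k + 1)) x).

Definition divergence f : 'rV[R]_3 -> R :=
  fun x => \sum_(i < 3) pd i (coord f i) x.

(* Euclidean norms; the library norm on matrices is the maximum norm. *)
Definition enorm x : R := Num.sqrt (\sum_(k < 3) x 0 k ^+ 2).

Definition hessian_norm f x : R :=
  Num.sqrt (\sum_(i < 3) \sum_(j < 3) \sum_(k < 3)
              pd i (pd j (coord f k)) x ^+ 2).

(* Lebesgue measure on R^3 lives on the measurable type R * R * R;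
   functions on 'rV[R]_3 are integrated after composition with [vec3]. *)
Definition vec3 (p : R * R * R) : 'rV[R]_3 :=
  \row_k tnth [tuple p.1.1; p.1.2; p.2] k.

Definition leb3 : {measure set (measurableTypeR R * measurableTypeR R *
                                measurableTypeR R)%type -> \bar R} :=
  ((@lebesgue_measure R \x @lebesgue_measure R) \x @lebesgue_measure R)%E.

Definition Lp_norm (p : \bar R) (g : 'rV[R]_3 -> R) : \bar R :=
  Lnorm leb3 p (fun q => (g (vec3 q))%:E).

End VectorCalculus.

Section ElectronMHD.
Context {R : realType}.
Implicit Types (J : set R) (B : R -> 'rV[R]_3 -> 'rV[R]_3).

Definition continuous_slab J (g : R -> 'rV[R]_3 -> R) : Prop :=
  {within J `*` [set: 'rV[R]_3], continuous (fun p => g p.1 p.2)}.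

(* Classical regularity on R^3 x J: space derivatives up to order 2 exist and
   are continuous up to the left endpoint of J (if it belongs to J), and the
   time derivative exists in the interior of J. For a solution of the equation
   below the time derivative then extends continuously to the left endpoint. *)
Definition classical_on J B : Prop :=
  (forall t, interior J t -> forall x, derivable (fun s => B s x) t 1) /\
  forall k : 'I_3,
    let b t := coord (B t) k in
    continuous_slab J b /\
    forall j : 'I_3,
      (forall t, J t -> forall x, derivable (b t) x (delta_mx 0 j)) /\
      continuous_slab J (fun t => pd j (b t)) /\
      forall i : 'I_3,
        (forall t, J t -> forall x, derivable (pd j (b t)) x (delta_mx 0 i)) /\
        continuous_slab J (fun t => pd i (pd j (b t))).

Definition electron_mhd J B : Prop :=
  (forall t, interior J t -> forall x,
     derive1 (fun s => B s x) t
       + curl (fun y => crossv (curl (B t) y) (B t y)) x = 0) /\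
  (forall t, J t -> forall x, divergence (B t) x = 0).

Definition pseudo_self_similar J (lambda mu : R -> R)
    (H : 'rV[R]_3 -> 'rV[R]_3) B : Prop :=
  forall t, J t -> forall x, B t x = mu t *: H (lambda t *: x).

Definition bounded_energy (T : R) B : Prop :=
  (ess_sup (mrestr (@lebesgue_measure R) (measurable_itv `]0%R, T[))
     (fun t => Lp_norm 2%:E (fun x => enorm (B t x))) < +oo)%E.

Definition int_D2_Linfty B (t : R) : \bar R :=
  (\int[@lebesgue_measure R]_(s in `[0%R, t])
      Lp_norm +oo (hessian_norm (B s)))%E.

(* Divergence to +oo of a finite function of t < T. Without finiteness the
   limit would also hold for fields whose second derivatives are unbounded at
   every time, where no singularity forms at T. *)
Definition D2_blowup (T : R) B : Prop :=
  (forall t, 0 <= t < T -> (int_D2_Linfty B t < +oo)%E) /\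
  (int_D2_Linfty B t @[t --> T^'-] --> +oo%E).

End ElectronMHD.

(* Main.v *)
Require Import Defs.
From HB Require Import structures.
From mathcomp Require Import all_boot all_order all_algebra.
From mathcomp Require Import all_classical all_reals all_analysis.
From mathcomp Require Import measurable_realfun ess_sup_inf.
From mathcomp Require Import ring lra.

Import Order.TTheory GRing.Theory Num.Theory.
Import numFieldNormedType.Exports.

Local Open Scope classical_set_scope.
Local Open Scope ring_scope.

(* A profile carried at two times satisfies two stationary equations
   alpha H + beta y.grad H + gamma curl (curl H x H) = 0; eliminating the Hall
   term leaves alpha H + beta y.grad H = 0. Testing such an equation with H and
   using H in L^2 gives conservation of energy, alpha = 3 beta / 2: on the box
   [-a, a]^3 one integrates the divergence of the energy flux times the weight
   prod (1 - (y_i / a)^2), which vanishes on the boundary, and lets a tend to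
   infinity; a bounded Hessian makes curl H grow at most linearly, which the
   factor 1 / a in the gradient of the weight compensates. If gamma = 0, H is
   then homogeneous of degree -3/2 and continuous at 0, hence zero unless
   alpha = beta = 0. So after normalization at a time t0 the rates are constant,
   mu' = 3 c lambda^2 mu^2 and lambda' = 2 c lambda^3 mu, whence mu^2 = lambda^3
   and lambda^2 mu (1 - 7 c (t - t0)) = 1. The blow-up of the integral of
   lambda^2 mu forces 1 - 7 c (T - t0) = 0, which is the excluded scaling. *)

(* [vector.coord] shadows it. *)
Local Notation coord := Defs.coord.

(** * Partial derivatives on R^3 *)

(** The profile [H] comes with no regularity, and [lambda] and [mu] may vanish or change sign. This
    is why a time slice of [B] takes the place of [H]. The slice must be taken where both factors
    are nonzero, the energy is finite and the Hessian is bounded. The hypotheses give the last two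
    only at some times of each interval, possibly different ones, but all slices are dilates of each
    other, which carries the Hessian bound from one time to another. The rates of [lambda] and [mu]
    are obtained only where these do not vanish, so the ODE is solved by a continuity argument in
    time that propagates positivity together with the conservation laws. A polynomial weight on a
    box, rather than a smooth cutoff on a ball, reduces the divergence theorem to Fubini and the
    one-dimensional fundamental theorem of calculus. The constant 7 is the growth rate of
    [lambda^2 mu]: two factors of rate 2 and one of rate 3, in units of [c]. *)

Section Ord3.

Lemma sum3 {V : nmodType} (F : 'I_3 -> V) : \sum_(i < 3) F i = F 0 + F 1 + F 2.
Proof.
rewrite !big_ord_recl big_ord0 addr0 addrA.
by congr (F _ + F _ + F _); apply/val_inj.
Qed.

Lemma ord3P (P : 'I_3 -> Prop) : P 0 -> P 1 -> P 2 -> forall i, P i.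
Proof.
move=> P0 P1 P2 [[|[|[|//]]] lti].
- by have -> : Ordinal lti = 0 by apply/val_inj.
- by have -> : Ordinal lti = 1 by apply/val_inj.
- by have -> : Ordinal lti = 2 by apply/val_inj.
Qed.

Lemma ord3D : ((0 + 1 = 1 :> 'I_3)%R * (0 + 2 = 2 :> 'I_3)%R *
  (1 + 1 = 2 :> 'I_3)%R * (1 + 2 = 0 :> 'I_3)%R * (2 + 1 = 0 :> 'I_3)%R *
  (2 + 2 = 1 :> 'I_3)%R)%type.
Proof. by do !split; apply/val_inj. Qed.

End Ord3.

Section PartialDerivatives.
Context {R : realType}.
Implicit Types (f g : 'rV[R]_3 -> R) (x v h : 'rV[R]_3).

Lemma rV3E x : x = x 0 0 *: delta_mx 0 0 + x 0 1 *: delta_mx 0 1 + x 0 2 *: delta_mx 0 2.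
Proof. by rewrite {1}[x]row_sum_delta sum3. Qed.

Lemma is_derive_line f (i : 'I_3) x (s : R) :
  derivable f (x + s *: delta_mx 0 i) (delta_mx 0 i) ->
  is_derive s 1 (fun r => f (x + r *: delta_mx 0 i)) (pd i f (x + s *: delta_mx 0 i)).
Proof.
move=> df.
have E : (fun h : R => h^-1 *: ((f \o shift (x + s *: delta_mx 0 i)) (h *: delta_mx 0 i)
           - f (x + s *: delta_mx 0 i))) =
   (fun h : R => h^-1 *: (((fun r : R => f (x + r *: delta_mx 0 i)) \o shift s) (h *: 1)
           - f (x + s *: delta_mx 0 i))).
  apply/funext => h /=; congr (_ *: (f _ - _)).
  by rewrite scalerDl addrCA [h *: 1]mulr1.
by split; rewrite /derivable /pd /derive -E.
Qed.

Lemma mean_value_line f (i : 'I_3) x (a : R) :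
  (forall y, derivable f y (delta_mx 0 i)) ->
  exists2 c, `|c| <= `|a| &
    f (x + a *: delta_mx 0 i) - f x = a * pd i f (x + c *: delta_mx 0 i).
Proof.
move=> df.
pose F (r : R) := f (x + r *: delta_mx 0 i).
have dF (r : R) : is_derive r 1 F (pd i f (x + r *: delta_mx 0 i)).
  exact: is_derive_line.
have cF : continuous F.
  move=> r; apply: differentiable_continuous; apply/derivable1_diffP.
  by case: (dF r).
have F0 : F 0 = f x by rewrite /F scale0r addr0.
have [a0|a0] := leP 0 a.
- have [c ci E] := @MVT_segment R F _ 0 a a0 (fun r _ => dF r)
    (continuous_subspaceT cF).
  move: ci; rewrite in_itv /= => /andP[c0 ca].
  exists c; first by rewrite !ger0_norm.
  by rewrite -F0 E subr0 mulrC.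
- have [c ci E] := @MVT_segment R F _ a 0 (ltW a0) (fun r _ => dF r)
    (continuous_subspaceT cF).
  move: ci; rewrite in_itv /= => /andP[ac c0].
  exists c; first by rewrite !ler0_norm ?(ltW a0)// lerN2.
  by rewrite -F0 -opprB E sub0r mulrN opprK mulrC.
Qed.

(** Only partial derivatives are at hand, so the path from [x] to [x + h] follows the three axes in
    turn, with one mean value point on each leg. *)
Lemma mean_value3 f x h :
  (forall i y, derivable f y (delta_mx 0 i)) ->
  exists2 c : 'I_3 -> 'rV[R]_3,
    (forall i j, `|c i 0 j - x 0 j| <= `|h 0 j|) &
    f (x + h) - f x = \sum_(i < 3) h 0 i * pd i f (c i).
Proof.
move=> df.
pose e (i : 'I_3) : 'rV[R]_3 := delta_mx 0 i.
have [c0 c0h E0] := mean_value_line f 0 x (h 0 0) (df 0).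
have [c1 c1h E1] := mean_value_line f 1 (x + h 0 0 *: e 0) (h 0 1) (df 1).
have [c2 c2h E2] := mean_value_line f 2 (x + h 0 0 *: e 0 + h 0 1 *: e 1) (h 0 2) (df 2).
exists (fun i => if i == 0 then x + c0 *: e 0
         else if i == 1 then x + h 0 0 *: e 0 + c1 *: e 1
         else x + h 0 0 *: e 0 + h 0 1 *: e 1 + c2 *: e 2).
  have E (a b c : R) j : (a *: e 0 + b *: e 1 + c *: e 2) 0 j =
      if j == 0 then a else if j == 1 then b else c.
    rewrite !mxE eqxx /=; move: j; apply: ord3P => /=;
      by rewrite ?mulr0 ?mulr1 ?addr0 ?add0r.
  have n0 : `|0 : R| = 0 by rewrite normr0.
  apply: ord3P => j /=.
  - have -> : x + c0 *: e 0 = x + (c0 *: e 0 + 0 *: e 1 + 0 *: e 2).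
      by rewrite !scale0r !addr0.
    rewrite mxE [x 0 j + _]addrC addrK E; move: j.
    by apply: ord3P => //=; rewrite n0.
  - have -> : x + h 0 0 *: e 0 + c1 *: e 1 = x + (h 0 0 *: e 0 + c1 *: e 1 + 0 *: e 2).
      by rewrite !scale0r !addr0 addrA.
    rewrite mxE [x 0 j + _]addrC addrK E; move: j.
    by apply: ord3P => //=; rewrite n0.
  - rewrite -2!addrA mxE [x 0 j + _]addrC addrK (addrA (h 0 0 *: e 0)) E; move: j.
    by apply: ord3P.
rewrite sum3 /= -E0 -E1 -E2.
rewrite {1}(rV3E h) !addrA -/(e 0) -/(e 1) -/(e 2).
by ring.
Qed.

End PartialDerivatives.

Definition C1fun {R : realType} (f : 'rV[R]_3 -> R) : Prop :=
  continuous f /\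
  forall i, (forall x, derivable f x (delta_mx 0 i)) /\ continuous (pd i f).

Section C1Functions.
Context {R : realType}.
Implicit Types (f g : 'rV[R]_3 -> R) (x : 'rV[R]_3).

Lemma C1fun_continuous f : C1fun f -> continuous f.
Proof. by case. Qed.

Lemma C1fun_continuous_pd f i : C1fun f -> continuous (pd i f).
Proof. by case=> _ /(_ i) []. Qed.


Lemma line_is_derive f (i : 'I_3) x (d : R) :
  is_derive (0 : R) 1 (fun r : R => f (x + r *: delta_mx 0 i)) d ->
  is_derive x (delta_mx 0 i) f d.
Proof.
have E : (fun h : R => h^-1 *: ((f \o shift x) (h *: delta_mx 0 i) - f x)) =
   (fun h : R => h^-1 *: (((fun r : R => f (x + r *: delta_mx 0 i)) \o shift 0) (h *: 1)
           - f (x + 0 *: delta_mx 0 i))).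
  apply/funext => h /=; rewrite scale0r addr0 [h *: 1]mulr1.
  by rewrite addr0 [X in f X]addrC.
by case=> dF F; split; rewrite /derivable /derive E.
Qed.

Lemma is_derive_dilation f (i : 'I_3) (c : R) x :
  derivable f (c *: x) (delta_mx 0 i) ->
  is_derive x (delta_mx 0 i) (fun y => f (c *: y)) (c * pd i f (c *: x)).
Proof.
move=> df; apply: line_is_derive.
have -> : (fun r : R => f (c *: (x + r *: delta_mx 0 i))) =
   (fun r : R => f (c *: x + r *: delta_mx 0 i)) \o ( *%R c).
  by apply/funext => r /=; rewrite scalerDr scalerA.
have d1 : is_derive (c * 0) 1 (fun r : R => f (c *: x + r *: delta_mx 0 i))
    (pd i f (c *: x)).
  have := @is_derive_line R f i (c *: x) (c * 0).
  by rewrite mulr0 scale0r addr0; apply.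
have d2 : is_derive (0 : R) 1 ( *%R c) c.
  by apply: is_derive_eq; rewrite [LHS]mulr1.
by rewrite mulrC; exact: is_derive1_comp.
Qed.

(** The mean value points differ from [r *: x] by at most [h *: x] in each coordinate, so continuity
    of the partial derivatives gives the limit of the difference quotient. *)
Lemma is_derive_ray f x (r : R) : C1fun f ->
  is_derive r 1 (fun s : R => f (s *: x)) (\sum_(i < 3) x 0 i * pd i f (r *: x)).
Proof.
move=> [_ C1f].
have df i y : derivable f y (delta_mx 0 i) by have [+ _] := C1f i; apply.
have cf i : continuous (pd i f) by have [] := C1f i.
pose L := \sum_(i < 3) x 0 i * pd i f (r *: x).
suff cL : h^-1 *: (((fun s : R => f (s *: x)) \o shift r) (h *: 1) - f (r *: x))
    @[h --> (0:R)^'] --> L.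
  by split; [apply/cvg_ex; exists L | exact: cvg_lim cL].
have cval (h : R) : {c : 'I_3 -> 'rV[R]_3 |
    (forall i j, `|c i 0 j - (r *: x) 0 j| <= `|(h *: x) 0 j|) /\
    f (r *: x + h *: x) - f (r *: x) = \sum_(i < 3) (h *: x) 0 i * pd i f (c i)}.
  by apply: cid; have [c ? ?] := @mean_value3 R f (r *: x) (h *: x) df; exists c.
pose c h := sval (cval h).
have cP h := svalP (cval h).
have cc (i : 'I_3) : c h i @[h --> (0:R)^'] --> r *: x.
  apply/cvgrPdist_le => /= e e0; near=> h.
  rewrite /Num.Def.normr/= mx_normrE (bigmax_le _ (ltW e0))//= => -[k j] _ /=.
  rewrite !mxE distrC.
  have [+ _] := cP h => /(_ i j); rewrite !mxE (ord1 k) => /le_trans; apply.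
  rewrite normrM.
  (* The added 1 keeps the divisor positive when [x = 0]. *)
  have : `|x 0 j| <= `|x| + 1.
    apply: (@le_trans _ _ `|x|); last by rewrite lerDl.
    by rewrite [leRHS]/Num.Def.normr/= mx_normrE; exact: (le_bigmax _ _ (0, j)).
  move=> /(ler_wpM2l (normr_ge0 h)) /le_trans; apply.
  rewrite -ler_pdivlMr ?ltr_wpDl//.
  by near: h; apply: dnbhs0_le; rewrite divr_gt0// ltr_wpDl.
have cvS : (\sum_(i < 3) x 0 i * pd i f (c h i)) @[h --> (0:R)^'] --> L.
  rewrite /L sum3; under eq_fun do rewrite sum3.
  have ci i : x 0 i * pd i f (c h i) @[h --> (0:R)^'] --> x 0 i * pd i f (r *: x).
    apply: cvgM; first exact: cvg_cst.
    exact: (cvg_comp _ _ (cc i) (cf i _)).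
  by apply: cvgD => //; exact: cvgD.
apply: cvg_trans cvS; apply: near_eq_cvg; near=> h.
have h0 : h != 0 by near: h; exact: nbhs_dnbhs_neq.
have [_] := cP h.
rewrite /= [h *: 1]mulr1 scalerDl [h *: x + _]addrC => ->.
rewrite scaler_sumr; apply: eq_bigr => i _.
by rewrite mxE -mulrA; apply/esym; exact: mulKf.
Unshelve. all: by end_near. Qed.

Lemma is_derive_time_dilation f x (l : R -> R) (t dl : R) : C1fun f ->
  is_derive t 1 l dl ->
  is_derive t 1 (fun s => f (l s *: x)) (dl * \sum_(i < 3) x 0 i * pd i f (l t *: x)).
Proof.
move=> C1f dlt; have dr := is_derive_ray f x (l t) C1f.
by rewrite mulrC; exact: (@is_derive1_comp _ _ _ _ _ _ dr dlt).
Qed.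

Lemma linear_growth f (K : R) :
  (forall i y, derivable f y (delta_mx 0 i)) ->
  (forall i y, `|pd i f y| <= K) ->
  forall x, `|f x| <= `|f 0| + K * \sum_(i < 3) `|x 0 i|.
Proof.
move=> df bK x; have [c _] := @mean_value3 R f 0 x df.
rewrite add0r => /eqP; rewrite subr_eq => /eqP ->.
rewrite addrC (le_trans (ler_normD _ _))// lerD2l (le_trans (ler_norm_sum _ _ _))//.
rewrite mulr_sumr; apply: ler_sum => i _.
by rewrite normrM mulrC; apply: ler_wpM2r.
Qed.

Lemma C1fun_cst (a : R) : C1fun (fun _ => a).
Proof.
split; first exact: cst_continuous.
move=> i; split; first by move=> x; exact: derivable_cst.
have -> : pd i (fun _ => a) = fun _ => 0 by apply/funext => x; exact: derive_cst.
exact: cst_continuous.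
Qed.

Lemma is_derive_coord (i k : 'I_3) x :
  is_derive x (delta_mx 0 i) (fun y : 'rV[R]_3 => y 0 k) ((i == k)%:R).
Proof.
apply: line_is_derive.
have -> : (fun r : R => (x + r *: delta_mx 0 i) 0 k) = cst (x 0 k) + ( *%R^~ ((i == k)%:R)).
  by apply/funext => r; rewrite !mxE eqxx /= [k == i]eq_sym.
apply: is_derive_eq; rewrite ?add0r scaler0 add0r.
exact: mulr1.
Qed.

Lemma pd_coord (i k : 'I_3) x : pd i (fun y : 'rV[R]_3 => y 0 k) x = (i == k)%:R.
Proof. by apply: derive_val; exact: is_derive_coord. Qed.

Lemma C1fun_coord (k : 'I_3) : C1fun (fun x : 'rV[R]_3 => x 0 k).
Proof.
split; first exact: coord_continuous.
move=> i; split; first by move=> x; case: (is_derive_coord i k x).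
have -> : pd i (fun y : 'rV[R]_3 => y 0 k) = fun _ => (i == k)%:R.
  by apply/funext => x; rewrite pd_coord.
exact: cst_continuous.
Qed.

Lemma C1fun_derivable f i x : C1fun f -> derivable f x (delta_mx 0 i).
Proof. by move=> [_ /(_ i) []]. Qed.

Lemma pdD f g i x : C1fun f -> C1fun g ->
  pd i (fun y => f y + g y) x = pd i f x + pd i g x.
Proof. by move=> Cf Cg; apply: deriveD; exact: C1fun_derivable. Qed.

Lemma pdM f g i x : C1fun f -> C1fun g ->
  pd i (fun y => f y * g y) x = f x * pd i g x + g x * pd i f x.
Proof. by move=> Cf Cg; apply: deriveM; exact: C1fun_derivable. Qed.

Lemma pdB f g i x : C1fun f -> C1fun g ->
  pd i (fun y => f y - g y) x = pd i f x - pd i g x.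
Proof. by move=> Cf Cg; apply: deriveB; exact: C1fun_derivable. Qed.

Lemma C1funD f g : C1fun f -> C1fun g -> C1fun (fun x => f x + g x).
Proof.
move=> Cf Cg; split; first by move=> x; apply: continuousD; exact: C1fun_continuous.
move=> i; split; first by move=> x; apply: derivableD; exact: C1fun_derivable.
have -> : pd i (fun y => f y + g y) = fun x => pd i f x + pd i g x.
  by apply/funext => x; rewrite pdD.
by move=> x; apply: continuousD; exact: C1fun_continuous_pd.
Qed.

Lemma C1funB f g : C1fun f -> C1fun g -> C1fun (fun x => f x - g x).
Proof.
move=> Cf Cg; split; first by move=> x; apply: continuousB; exact: C1fun_continuous.
move=> i; split; first by move=> x; apply: derivableB; exact: C1fun_derivable.
have -> : pd i (fun y => f y - g y) = fun x => pd i f x - pd i g x.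
  by apply/funext => x; rewrite pdB.
by move=> x; apply: continuousB; exact: C1fun_continuous_pd.
Qed.

Lemma C1funM f g : C1fun f -> C1fun g -> C1fun (fun x => f x * g x).
Proof.
move=> Cf Cg; split; first by move=> x; apply: continuousM; exact: C1fun_continuous.
move=> i; split; first by move=> x; apply: derivableM; exact: C1fun_derivable.
have -> : pd i (fun y => f y * g y) = fun x => f x * pd i g x + g x * pd i f x.
  by apply/funext => x; rewrite pdM.
move=> x; apply: (@continuousD _ _ _ (fun y => f y * pd i g y)
  (fun y => g y * pd i f y)); apply: continuousM.
- exact: C1fun_continuous.
- exact: C1fun_continuous_pd.
- exact: C1fun_continuous.
- exact: C1fun_continuous_pd.
Qed.

End C1Functions.

(** * Integration on boxes of R^3 *)

Section CaratheodoryFunctions.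
Context d (T : measurableType d) (R : realType).

(** Rounding the second variable down to the grid of mesh [1 / (n + 1)] makes every preimage a
    countable union of measurable rectangles. *)
Lemma measurable_fun_grid (f : T * measurableTypeR R -> R) (n : nat) :
  (forall x, measurable_fun setT (fun t => f (t, x))) ->
  measurable_fun setT
    (fun p : T * measurableTypeR R => f (p.1, (Num.floor ((p.2 : R) * n.+1%:R))%:~R / n.+1%:R)).
Proof.
move=> mf _ A mA; rewrite setTI.
pose G (k : int) : set (T * measurableTypeR R) :=
  ((fun t => f (t, k%:~R / n.+1%:R)) @^-1` A) `*`
  ((fun x : R => x * n.+1%:R) @^-1` `[k%:~R, (k + 1)%:~R[).
rewrite (_ : _ @^-1` A = \bigcup_k G k); last first.
  apply/seteqP; split => [[t x] /= Atx|[t x] [k _ [/= Atk]]].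
  - exists (Num.floor (x * n.+1%:R)) => //; split => //=.
    by rewrite in_itv /= floor_itv.
  - by rewrite in_itv /= => /floor_def ->.
apply: countable_bigcupT_measurable; first exact: countableP.
move=> k; apply: measurableX.
- by rewrite -[X in measurable X]setTI; exact: mf.
- have mM : measurable_fun setT (fun x : R => x * n.+1%:R).
    by apply: continuous_measurable_fun; exact: mulrr_continuous.
  by rewrite -[X in measurable X]setTI; apply: mM.
Qed.

Lemma measurable_fun_caratheodory (f : T * measurableTypeR R -> R) :
  (forall x, measurable_fun setT (fun t => f (t, x))) ->
  (forall t, continuous (fun x : R => f (t, x))) ->
  measurable_fun setT f.
Proof.
move=> mf cf.
apply: (@measurable_fun_cvg _ _ _ setT
  (fun n (p : T * measurableTypeR R) => f (p.1, (Num.floor ((p.2 : R) * n.+1%:R))%:~R / n.+1%:R))).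
  by move=> n; exact: measurable_fun_grid.
move=> [t x] _ /=.
apply: (cvg_comp (fun n : nat => (Num.floor (x * n.+1%:R))%:~R / n.+1%:R)
  (fun x : R => f (t, x))); last exact: cf.
apply/cvgrPdist_le => /= e e0.
have := @cvg_harmonic R => /cvgrPdist_le /(_ e e0); apply: filterS => n.
rewrite /harmonic /= sub0r normrN; apply: le_trans.
have n0 : 0 < n.+1%:R :> R by rewrite ltr0n.
rewrite [leRHS]ger0_norm ?invr_ge0 ?(ltW n0)//.
rewrite -{1}(mulfK (lt0r_neq0 n0) x) -mulrBl normrM [X in _ * X]ger0_norm ?invr_ge0 ?(ltW n0)//.
rewrite ler_piMl ?invr_ge0 ?(ltW n0)//.
have := floor_le (x * n.+1%:R); have := floorD1_gt (x * n.+1%:R).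
rewrite intrD => h1 h2; rewrite ger0_norm; lra.
Qed.

End CaratheodoryFunctions.

Section Integration3.
Context {R : realType}.
Implicit Types (F : 'rV[R]_3 -> R).

Local Notation mR := (measurableTypeR R).
Local Notation mR3 := (measurableTypeR R * measurableTypeR R * measurableTypeR R)%type.

Lemma vec3E (x y z : R) :
  vec3 (x, y, z) = x *: delta_mx 0 0 + y *: delta_mx 0 1 + z *: delta_mx 0 2.
Proof. by rewrite [LHS]rV3E !mxE. Qed.

Lemma vec3_coord (p : R * R * R) :
  ((vec3 p 0 0 = p.1.1) * (vec3 p 0 1 = p.1.2) * (vec3 p 0 2 = p.2))%type.
Proof. by rewrite !mxE. Qed.

Lemma continuous_line F (u v : 'rV[R]_3) : continuous F ->
  continuous (fun r : R => F (u + r *: v)).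
Proof.
move=> cF r; apply: (cvg_comp (fun r : R => u + r *: v) F); last exact: cF.
by apply: cvgD; [exact: cvg_cst | apply: cvgZr_tmp; exact: cvg_id].
Qed.

(** The sigma-algebra on triples is an iterated product, so the variables are added one at a time,
    using continuity of [F] along lines. *)
Lemma measurable_vec3 F : continuous F ->
  measurable_fun [set: mR3] (fun p => F (vec3 p)).
Proof.
move=> cF.
apply: (@measurable_fun_caratheodory _ (mR * mR)%type R (fun p : mR3 => F (vec3 p))) => [z|[x y]]; last first.
  under eq_fun do rewrite vec3E.
  exact: continuous_line.
apply: (@measurable_fun_caratheodory _ mR R (fun p : mR * mR => F (vec3 (p, z)))) => [y|x].
- apply: continuous_measurable_fun.
  under eq_fun do rewrite vec3E -addrA addrC.
  exact: continuous_line.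
- under eq_fun do rewrite vec3E addrAC.
  exact: continuous_line.
Qed.

Definition box (a : R) : set mR3 := (`[- a, a] `*` `[- a, a]) `*` `[- a, a].

Lemma boxP (a : R) p : box a p <-> forall i, `|vec3 p 0 i| <= a.
Proof.
rewrite /box /= !in_itv /= -!ler_norml; split => [[[h0 h1] h2]|h].
  by apply: ord3P; rewrite vec3_coord.
by have := h 0; have := h 1; have := h 2; rewrite !vec3_coord.
Qed.

Lemma measurable_box a : measurable (box a).
Proof. by do 2 apply: measurableX => //. Qed.

Lemma bounded_on_box F (a : R) : continuous F ->
  exists M, forall p, box a p -> `|F (vec3 p)| <= M.
Proof.
move=> cF.
have [a0|a0] := ltP a 0.
  by exists 0 => p /boxP /(_ 0) /le_lt_trans /(_ a0); rewrite normr_lt0.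
pose A := [set x : 'rV[R]_3 | forall i, `[- a, a]%classic (x 0 i)].
have cA : compact A.
  by apply: (@rV_compact R 3 (fun=> `[- a, a]%classic)) => i; exact: segment_compact.
have A0 : A !=set0 by exists 0 => i; rewrite /= !mxE in_itv /= oppr_le0 a0.
have cnF : {within A, continuous (fun x => `|F x|)}.
  apply: continuous_subspaceT => x.
  by apply: (cvg_comp F Num.norm); [exact: cF | exact: norm_continuous].
have [c _ cM] := EVT_max_rV A0 cA cnF.
exists `|F c| => p /boxP pa; apply: cM; rewrite inE => i /=.
by rewrite in_itv /= -ler_norml.
Qed.

Lemma leb3_box_lty a : (leb3 (box a) < +oo :> \bar R)%E.
Proof.
have I (b : R) : (@lebesgue_measure R `[(- b)%R, b] < +oo)%E.
  by rewrite lebesgue_measure_itv /=; case: ifP => _; rewrite ?ltry// -EFinD ltry.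
have -> : leb3 (box a) =
    ((@lebesgue_measure R \x @lebesgue_measure R)%E (`[(- a)%R, a] `*` `[(- a)%R, a])
     * @lebesgue_measure R `[(- a)%R, a])%E.
  by apply: product_measure1E => //; exact: measurableX.
have -> : (@lebesgue_measure R \x @lebesgue_measure R)%E (`[(- a)%R, a] `*` `[(- a)%R, a]) =
    (@lebesgue_measure R `[(- a)%R, a] * @lebesgue_measure R `[(- a)%R, a])%E.
  by apply: product_measure1E.
have I' : @lebesgue_measure R `[(- a)%R, a] \is a fin_num.
  by rewrite ge0_fin_numE// I.
by apply: lte_mul_pinfty; rewrite ?mule_ge0 ?fin_numM// I.
Qed.

Lemma integrable_box F a : continuous F ->
  leb3.-integrable (box a) (fun p => (F (vec3 p))%:E).
Proof.
move=> cF; apply: measurable_bounded_integrable.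
- exact: measurable_box.
- exact: leb3_box_lty.
- by apply: measurable_funTS; exact: measurable_vec3.
- have [M FM] := bounded_on_box F a cF.
  exists M; split; first exact: num_real.
  by move=> r Mr p /FM /le_trans; apply; exact: ltW.
Qed.

Lemma integral_line_pd F (i : 'I_3) (a : R) (u : 'rV[R]_3) : 0 < a -> C1fun F ->
  u 0 i = 0 ->
  (forall x : 'rV[R]_3, `|x 0 i| = a -> F x = 0) ->
  (\int[@lebesgue_measure R]_(r in `[(- a)%R, a])
     (pd i F (u + r *: delta_mx 0 i)%R)%:E = 0)%E.
Proof.
move=> a0 CF u0 F0.
pose f (r : R) := F (u + r *: delta_mx 0 i).
have df (r : R) : is_derive r 1 f (pd i F (u + r *: delta_mx 0 i)).
  by apply: is_derive_line; exact: C1fun_derivable.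
have cf : continuous f.
  by apply: continuous_line; exact: C1fun_continuous.
have f0 b : `|b| = a -> f b = 0.
  by move=> ba; apply: F0; rewrite !mxE u0 !eqxx /= mulr1 add0r.
rewrite (@continuous_FTC2 _ _ f).
- by rewrite !f0 ?normrN ?ger0_norm ?(ltW a0)// subee.
- by rewrite -subr_gt0 opprK addr_gt0.
- apply: continuous_subspaceT; apply: continuous_line.
  exact: C1fun_continuous_pd.
- split.
  + by move=> r _; case: (df r).
  + by apply: cvg_at_right_filter; exact: cf.
  + by apply: cvg_at_left_filter; exact: cf.
- move=> r _; rewrite derive1E.
  by apply: derive_val; exact: df.
Qed.

End Integration3.

Section BoxIntegrals.
Context {R : realType}.
Implicit Types (F : 'rV[R]_3 -> R).

Local Notation mR := (measurableTypeR R).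
Local Notation mu := (@lebesgue_measure R).
Local Notation I a := (`[(- a)%R, a%R]%classic : set mR).

(* Unification does not find the sigma-finite structure of a product that is
   itself a factor of a product in reasonable time; this copy carries its own. *)
Definition leb2 : set (mR * mR) -> \bar R := (mu \x mu)%E.
HB.instance Definition _ := Measure.on leb2.

Lemma leb2_square_lty (a : R) : (leb2 (`[(- a)%R, a] `*` `[(- a)%R, a]) < +oo)%E.
Proof.
rewrite /leb2 product_measure1E//.
have Ia : (mu `[(- a)%R, a] < +oo)%E.
  by rewrite lebesgue_measure_itv /=; case: ifP => _; rewrite ?ltry// -EFinD ltry.
by apply: lte_mul_pinfty => //; rewrite ge0_fin_numE.
Qed.

Lemma leb2_sigma_finite : sigma_finite setT leb2.
Proof.
exists (fun n => `[- n%:R, n%:R] `*` `[- n%:R, n%:R]); last first.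
  by move=> n; split; [exact: measurableX | exact: leb2_square_lty].
apply/esym; rewrite -subTset => -[x y] _.
exists (Num.bound (Num.max `|x| `|y|)) => //=.
have := archi_boundP (_ : 0 <= Num.max `|x| `|y|).
rewrite le_max normr_ge0 => /(_ isT); rewrite gt_max => /andP[xb yb].
by rewrite !in_itv /= -!ler_norml !ltW.
Qed.

HB.instance Definition _ := Measure_isSigmaFinite.Build _ _ _ leb2 leb2_sigma_finite.

(** Here [f] is the restriction to a line of a function extended by zero outside a box, and [b]
    tells whether the line meets the box. *)
Lemma integral_patch_line (g : R -> R) (D : set mR) (b : bool) (f : R -> \bar R) :
  (forall r, f r = if b && (r \in D) then (g r)%:E else 0%E) ->
  (\int[mu]_(r in D) (g r)%:E = 0)%E -> (\int[mu]_r f r = 0)%E.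
Proof.
move=> fE g0; case: b fE => fE; last by rewrite integral0_eq// => r _; rewrite fE.
rewrite -g0 [RHS]integral_mkcond; apply: eq_integral => r _.
by rewrite fE patchE.
Qed.

Lemma integral_square_pd F (i : 'I_3) (a z : R) : 0 < a -> C1fun F -> i != 2 ->
  (forall x : 'rV[R]_3, `|x 0 i| = a -> F x = 0) ->
  (\int[leb2]_(q in I a `*` I a) (pd i F (vec3 (q, z)))%:E = 0)%E.
Proof.
move=> a0 CF i2 F0.
have mI2 : measurable (I a `*` I a) by exact: measurableX.
pose f := (fun q : mR * mR => (pd i F (vec3 (q, z)))%:E) \_ (I a `*` I a).
have cpd : continuous (pd i F) by exact: C1fun_continuous_pd.
have If : leb2.-integrable setT f.
  apply/integrable_restrict => //; rewrite setTI.
  apply: measurable_bounded_integrable => //.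
  - exact: leb2_square_lty.
  - apply: measurable_funTS.
    exact: (measurableT_comp (measurable_vec3 _ cpd) (pair2_measurable z)).
  (* The box is enlarged so that it contains the slice at height [z]. *)
  - have [M FM] := bounded_on_box _ (Num.max a `|z|) cpd.
    exists M; split; first exact: num_real.
    move=> r Mr [x y] /= [xa ya]; apply: le_trans (ltW Mr); apply: FM.
    move: xa ya; rewrite !in_itv /= -!ler_norml => xa ya.
    apply/boxP; apply: ord3P; rewrite vec3_coord /= le_max ?xa ?ya//.
    by rewrite lexx orbT.
have fE x y : f (x, y) = if (x \in I a) && (y \in I a)
    then (pd i F (vec3 (x, y, z)))%:E else 0%E.
  by rewrite /f patchE in_setX.
rewrite integral_mkcond -/f.
(* Both orders of integration are prepared; the one with variable [i] innermost is used, where the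
   line integral vanishes. *)
have E12 : _ = (\int[leb2]_q f q)%E := @integral12_prod_meas1 _ _ _ _ _ mu mu f If.
have E21 : _ = (\int[leb2]_q f q)%E := @integral21_prod_meas1 _ _ _ _ _ mu mu f If.
move: i i2 F0 @f If fE E12 E21 {cpd} => i.
move: i; apply: ord3P => // _ F0 f If fE E12 E21.
- apply: etrans (esym E21) _; rewrite /fubini_G; apply: integral0_eq => y _.
  apply: (@integral_patch_line (fun x => pd 0 F (vec3 (x, y, z))) (I a) (y \in I a)).
    by move=> x; rewrite fE andbC.
  have u0 : vec3 (0, y, z) 0 0 = 0 by rewrite vec3_coord.
  apply: etrans (integral_line_pd F 0 a _ a0 CF u0 F0).
  apply: eq_integral => x _; congr (pd _ _ _)%:E.
  by rewrite !vec3E scale0r add0r [RHS]addrC addrA.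
- apply: etrans (esym E12) _; rewrite /fubini_F; apply: integral0_eq => x _.
  apply: (@integral_patch_line (fun y => pd 1 F (vec3 (x, y, z))) (I a) (x \in I a)).
    by move=> y; rewrite fE.
  have u0 : vec3 (x, 0, z) 0 1 = 0 by rewrite vec3_coord.
  apply: etrans (integral_line_pd F 1 a _ a0 CF u0 F0).
  apply: eq_integral => y _; congr (pd _ _ _)%:E.
  by rewrite !vec3E scale0r addr0 addrAC.
Qed.

Lemma integral_box_pd F (i : 'I_3) (a : R) : 0 < a -> C1fun F ->
  (forall x : 'rV[R]_3, `|x 0 i| = a -> F x = 0) ->
  (\int[leb3]_(p in box a) (pd i F (vec3 p))%:E = 0)%E.
Proof.
move=> a0 CF F0.
pose f := (fun p : mR * mR * mR => (pd i F (vec3 p))%:E) \_ (box a).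
have If : leb3.-integrable setT f.
  apply/integrable_restrict => //; first exact: measurable_box.
  by rewrite setTI; apply: integrable_box; exact: C1fun_continuous_pd.
rewrite integral_mkcond -/f.
have E12 : _ = (\int[leb3]_p f p)%E := @integral12_prod_meas1 _ _ _ _ _ leb2 mu f If.
have E21 : _ = (\int[leb3]_p f p)%E := @integral21_prod_meas1 _ _ _ _ _ leb2 mu f If.
have [i2|i2] := eqVneq i 2.
- apply: etrans (esym E12) _; rewrite /fubini_F; apply: integral0_eq => -[x y] _.
  apply: (@integral_patch_line (fun z => pd i F (vec3 (x, y, z))) (I a)
     ((x \in I a) && (y \in I a))).
    by move=> z; rewrite /f patchE /box !in_setX.
  have u0 : vec3 (x, y, 0) 0 i = 0 by rewrite ?i2 vec3_coord.
  apply: etrans (integral_line_pd F i a _ a0 CF u0 F0).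
  apply: eq_integral => z _; congr (pd _ _ _)%:E.
  by rewrite !vec3E scale0r addr0 ?i2.
- apply: etrans (esym E21) _; rewrite /fubini_G; apply: integral0_eq => z _.
  have [zI|zI] := boolP (z \in I a).
  + apply: etrans (@integral_square_pd F i a z a0 CF i2 F0); rewrite [RHS]integral_mkcond.
    apply: eq_integral => q _; rewrite /f !patchE /box in_setX zI andbT.
    by [].
  + by apply: integral0_eq => q _; rewrite /f patchE /box in_setX (negbTE zI) andbF.
Qed.

End BoxIntegrals.

(** * Energy balance for stationary profiles *)

Definition C2field {R : realType} (H : 'rV[R]_3 -> 'rV[R]_3) : Prop :=
  forall k, C1fun (coord H k) /\ forall j, C1fun (pd j (coord H k)).

Section WeightedIdentity.
Context {R : realType}.
Implicit Types (x : 'rV[R]_3) (H : 'rV[R]_3 -> 'rV[R]_3).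

(* For s = a^-2 it vanishes on the boundary of the box [-a, a]^3. *)
Definition weight (s : R) x : R :=
  (1 - s * (x 0 0 * x 0 0)) * (1 - s * (x 0 1 * x 0 1)) * (1 - s * (x 0 2 * x 0 2)).

Lemma C1fun_bump (s : R) (k : 'I_3) : C1fun (fun y : 'rV[R]_3 => 1 - s * (y 0 k * y 0 k)).
Proof.
by apply: C1funB; [exact: C1fun_cst | apply: C1funM; [exact: C1fun_cst |
    apply: C1funM; exact: C1fun_coord]].
Qed.

Lemma pd_cst (i : 'I_3) (a : R) x : pd i (fun _ => a) x = 0.
Proof. exact: derive_cst. Qed.

Lemma pd_bump (s : R) (i k : 'I_3) x :
  pd i (fun y : 'rV[R]_3 => 1 - s * (y 0 k * y 0 k)) x
  = - (2 * s * (x 0 k * (i == k)%:R)).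
Proof.
have Ck := @C1fun_coord R k; have Cc := @C1fun_cst R.
rewrite (pdB _ _ _ _ (Cc _) (C1funM _ _ (Cc _) (C1funM _ _ Ck Ck))).
rewrite (pdM _ _ _ _ (Cc _) (C1funM _ _ Ck Ck)) (pdM _ _ _ _ Ck Ck).
by rewrite pd_coord !pd_cst; ring.
Qed.

Lemma C1fun_weight (s : R) : C1fun (weight s).
Proof. by do 2 (apply: C1funM; last exact: C1fun_bump); exact: C1fun_bump. Qed.

Lemma pd_weight (s : R) (i : 'I_3) x : pd i (weight s) x =
  - (2 * s * x 0 i) *
  ((1 - s * (x 0 (i + 1) * x 0 (i + 1))) * (1 - s * (x 0 (i + 2) * x 0 (i + 2)))).
Proof.
have Cb := C1fun_bump s.
have -> : pd i (weight s) x =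
   (1 - s * (x 0 0 * x 0 0)) * (1 - s * (x 0 1 * x 0 1)) * - (2 * s * (x 0 2 * (i == 2)%:R)) +
   (1 - s * (x 0 2 * x 0 2)) * ((1 - s * (x 0 0 * x 0 0)) * - (2 * s * (x 0 1 * (i == 1)%:R)) +
    (1 - s * (x 0 1 * x 0 1)) * - (2 * s * (x 0 0 * (i == 0)%:R))).
  by rewrite /weight pdM ?pdM ?pd_bump//; exact: C1funM.
by move: i; apply: ord3P; rewrite ?ord3D /=; ring.
Qed.

Lemma C1fun_sum3 (f : 'I_3 -> 'rV[R]_3 -> R) : (forall i, C1fun (f i)) ->
  C1fun (fun x => \sum_(i < 3) f i x).
Proof.
move=> Cf; have -> : (fun x => \sum_(i < 3) f i x) = (fun x => f 0 x + f 1 x + f 2 x).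
  by apply/funext => x; rewrite sum3.
by do 2 (apply: C1funD => //).
Qed.

Lemma pd_sum3 (f : 'I_3 -> 'rV[R]_3 -> R) i x : (forall k, C1fun (f k)) ->
  pd i (fun x => \sum_(k < 3) f k x) x = \sum_(k < 3) pd i (f k) x.
Proof.
move=> Cf; have -> : (fun x => \sum_(i < 3) f i x) = (fun x => f 0 x + f 1 x + f 2 x).
  by apply/funext => y; rewrite sum3.
by rewrite pdD ?pdD ?sum3//; exact: C1funD.
Qed.

Definition sqnorm H x : R := \sum_(k < 3) coord H k x * coord H k x.

Lemma C1fun_sqnorm H : (forall k, C1fun (coord H k)) -> C1fun (sqnorm H).
Proof. by move=> CH; apply: C1fun_sum3 => k; exact: C1funM. Qed.

Lemma pd_sqnorm H i x : (forall k, C1fun (coord H k)) ->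
  pd i (sqnorm H) x = 2 * \sum_(k < 3) coord H k x * pd i (coord H k) x.
Proof.
move=> CH; rewrite /sqnorm pd_sum3; last by move=> k; exact: C1funM.
rewrite mulr_sumr; apply: eq_bigr => k _; rewrite pdM//; ring.
Qed.

Lemma coord_crossv (A B : 'rV[R]_3 -> 'rV[R]_3) k :
  coord (fun y => crossv (A y) (B y)) k =
  fun y => coord A (k + 1) y * coord B (k + 2) y - coord A (k + 2) y * coord B (k + 1) y.
Proof. by apply/funext => y; rewrite /Defs.coord mxE. Qed.

Lemma C1fun_crossv (A B : 'rV[R]_3 -> 'rV[R]_3) :
  (forall k, C1fun (coord A k)) -> (forall k, C1fun (coord B k)) ->
  forall k, C1fun (coord (fun y => crossv (A y) (B y)) k).
Proof. by move=> CA CB k; rewrite coord_crossv; apply: C1funB; exact: C1funM. Qed.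

Lemma coord_curl H k : coord (curl H) k =
  fun x => pd (k + 1) (coord H (k + 2)) x - pd (k + 2) (coord H (k + 1)) x.
Proof. by apply/funext => x; rewrite /Defs.coord mxE. Qed.

Lemma C1fun_curl H : C2field H -> forall k, C1fun (coord (curl H) k).
Proof.
move=> CH k; rewrite coord_curl.
by apply: C1funB; [case: (CH (k + 2)) => _; apply | case: (CH (k + 1)) => _; apply].
Qed.

Lemma pd_crossv (A B : 'rV[R]_3 -> 'rV[R]_3) i k x :
  (forall k, C1fun (coord A k)) -> (forall k, C1fun (coord B k)) ->
  pd i (coord (fun y => crossv (A y) (B y)) k) x =
  coord A (k + 1) x * pd i (coord B (k + 2)) x + coord B (k + 2) x * pd i (coord A (k + 1)) x
  - (coord A (k + 2) x * pd i (coord B (k + 1)) x + coord B (k + 1) x * pd i (coord A (k + 2)) x).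
Proof.
by move=> CA CB; rewrite coord_crossv pdB ?pdM//; exact: C1funM.
Qed.

(* In the paper alpha = mu' / (lambda^2 mu^2), beta = lambda' / (lambda^3 mu)
   and gamma = 1; gamma = 0 arises from the difference of two such equations. *)
Definition profile_eq (alpha beta gamma : R) H : Prop := forall x k,
  alpha * coord H k x + beta * (\sum_(i < 3) x 0 i * pd i (coord H k) x)
  + gamma * coord (curl (fun y => crossv (curl H y) (H y))) k x = 0.

(** With [G = curl H x H], the Hall term tested with [H] is the divergence of [G x H], because
    [div (G x H) = H . curl G - G . curl H] and [G] is orthogonal to [curl H]. The transport term is
    [H . (y.grad H) = div (y |H|^2 / 2) - 3/2 |H|^2], where 3 is the dimension. *)
Definition energy_flux (beta gamma : R) H (i : 'I_3) x : R :=
  beta / 2 * (x 0 i * sqnorm H x) +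
  gamma * coord (fun y => crossv (crossv (curl H y) (H y)) (H y)) i x.

Lemma C1fun_energy_flux beta gamma H i : C2field H -> C1fun (energy_flux beta gamma H i).
Proof.
move=> CH.
have C0 k : C1fun (coord H k) by have [] := CH k.
apply: C1funD; apply: C1funM; try exact: C1fun_cst.
  by apply: C1funM; [exact: C1fun_coord | exact: C1fun_sqnorm].
by apply: (C1fun_crossv _ _ _ C0); apply: (C1fun_crossv _ _ _ C0); exact: C1fun_curl.
Qed.

Lemma weighted_energy_identity (alpha beta gamma s : R) H x : C2field H ->
  profile_eq alpha beta gamma H ->
  \sum_(i < 3) pd i (fun y => weight s y * energy_flux beta gamma H i y) x =
  \sum_(i < 3) energy_flux beta gamma H i x * pd i (weight s) x
  + (3 / 2 * beta - alpha) * (weight s x * sqnorm H x).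
Proof.
move=> CH eqH.
have C0 k : C1fun (coord H k) by have [] := CH k.
have CJ := C1fun_curl H CH.
have CG := C1fun_crossv (curl H) H CJ C0.
have CX := C1fun_crossv (fun y => crossv (curl H y) (H y)) H CG C0.
have Cw := C1fun_weight s.
have CF i := C1fun_energy_flux beta gamma H i CH.
have Cs := C1fun_sqnorm H C0.
have dF i : pd i (energy_flux beta gamma H i) x =
    beta / 2 * (sqnorm H x + x 0 i * pd i (sqnorm H) x)
    + gamma * pd i (coord (fun y => crossv (crossv (curl H y) (H y)) (H y)) i) x.
  have Cc := @C1fun_cst R; have Ci := @C1fun_coord R i.
  rewrite (pdD _ _ _ _ (C1funM _ _ (Cc _) (C1funM _ _ Ci Cs)) (C1funM _ _ (Cc _) (CX i))).
  rewrite (pdM _ _ _ _ (Cc _) (C1funM _ _ Ci Cs)) (pdM _ _ _ _ Ci Cs) (pdM _ _ _ _ (Cc _) (CX i)).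
  by rewrite pd_coord eqxx !pd_cst /=; ring.
pose G := fun y => crossv (curl H y) (H y).
have Z : weight s x * \sum_(k < 3) coord H k x * (alpha * coord H k x
    + beta * (\sum_(i < 3) x 0 i * pd i (coord H k) x) + gamma * coord (curl G) k x) = 0.
  by rewrite big1 ?mulr0// => k _; rewrite eqH mulr0.
have -> : \sum_(i < 3) pd i (fun y => weight s y * energy_flux beta gamma H i y) x =
    \sum_(i < 3) (weight s x * (beta / 2 * (sqnorm H x + x 0 i *
      (2 * \sum_(k < 3) coord H k x * pd i (coord H k) x))
    + gamma * (coord G (i + 1) x * pd i (coord H (i + 2)) x
       + coord H (i + 2) x * pd i (coord G (i + 1)) x
       - (coord G (i + 2) x * pd i (coord H (i + 1)) x
       + coord H (i + 1) x * pd i (coord G (i + 2)) x)))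
    + energy_flux beta gamma H i x * pd i (weight s) x).
  apply: eq_bigr => i _; rewrite (pdM _ _ _ _ Cw (CF i)) dF (pd_sqnorm _ _ _ C0).
  by rewrite (pd_crossv _ _ _ _ _ CG C0).
(* The difference of the two sides equals the tested equation [Z] as a polynomial identity. The
   values of [G] are expanded, since [G . curl H = 0] must be visible, while the partial derivatives
   of [G] stay atoms. *)
apply/eqP; rewrite -subr_eq0; apply/eqP; rewrite -[RHS]Z.
have GE k : coord G k x =
    (pd (k + 1 + 1) (coord H (k + 1 + 2)) x - pd (k + 1 + 2) (coord H (k + 1 + 1)) x)
      * coord H (k + 2) x
    - (pd (k + 2 + 1) (coord H (k + 2 + 2)) x - pd (k + 2 + 2) (coord H (k + 2 + 1)) x)
      * coord H (k + 1) x.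
  by rewrite coord_crossv !coord_curl.
have CE k : coord (curl G) k x = pd (k + 1) (coord G (k + 2)) x - pd (k + 2) (coord G (k + 1)) x.
  by rewrite coord_curl.
rewrite /sqnorm !sum3 !CE !ord3D !GE !ord3D {Z dF CF eqH CE GE}.
move: (pd 0 (coord H 0) x) (pd 0 (coord G 0) x) (pd 0 (coord H 1) x)
  (pd 0 (coord G 1) x) (pd 0 (coord H 2) x) (pd 0 (coord G 2) x)
  => v0 v1 v2 v3 v4 v5.
move: (pd 1 (coord H 0) x) (pd 1 (coord G 0) x) (pd 1 (coord H 1) x)
  (pd 1 (coord G 1) x) (pd 1 (coord H 2) x) (pd 1 (coord G 2) x)
  => v6 v7 v8 v9 v10 v11.
move: (pd 2 (coord H 0) x) (pd 2 (coord G 0) x) (pd 2 (coord H 1) x)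
  (pd 2 (coord G 1) x) (pd 2 (coord H 2) x) (pd 2 (coord G 2) x)
  => v12 v13 v14 v15 v16 v17.
move: (pd 0 (weight s) x) (energy_flux beta gamma H 0 x) (coord H 0 x)
  (x 0 0) (pd 1 (weight s) x) (energy_flux beta gamma H 1 x)
  => v18 v19 v20 v21 v22 v23.
move: (coord H 1 x) (x 0 1) (pd 2 (weight s) x)
  (energy_flux beta gamma H 2 x) (coord H 2 x) (x 0 2)
  => v24 v25 v26 v27 v28 v29.
move: (weight s x) => w.
by field.
Qed.

End WeightedIdentity.

Section EnergyBalance.
Context {R : realType}.
Implicit Types (x : 'rV[R]_3) (H : 'rV[R]_3 -> 'rV[R]_3) (F : 'rV[R]_3 -> R).

(** If [F] exceeds [c] at a point, it does so on a cube of side [e] around it, and measure [e^3 > 0]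
    does not fit into a null set. *)
Lemma ae_vec3_le F (c : R) : continuous F ->
  {ae leb3, forall p, F (vec3 p) <= c} -> forall x, F x <= c.
Proof.
move=> cF [N [mN N0 FN]] x0; rewrite leNgt; apply/negP => Fx0.
have : nbhs x0 [set x | c < F x].
  apply: (cF x0 [set r | c < r]).
  exact: lt_nbhsr.
move=> /nbhs_ballP[e /= e0 xeF].
pose J i : set R := `[x0 0 i - e / 2, x0 0 i + e / 2]%classic.
have JF : (J 0 `*` J 1) `*` J 2 `<=` N.
  move=> p /= [[p0 p1] p2]; apply: FN => /=; apply/negP; rewrite -ltNge.
  apply: xeF; split => // k i; rewrite (ord1 k).
  have E (y : R) : J i y -> `|x0 0 i - y| < e.
    rewrite /J /= in_itv /= => /andP[y1 y2]; rewrite ltr_norml.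
    by apply/andP; split; lra.
  apply: E; move: i; apply: ord3P; rewrite vec3_coord //.
have muJ i : @lebesgue_measure R (J i) = e%:E.
  rewrite lebesgue_measure_itv /= lte_fin ifT; last by lra.
  by rewrite -EFinD; congr EFin; lra.
have : (leb3 ((J 0%R `*` J 1%R) `*` J 2%R) <= leb3 N)%E.
  apply: le_measure; rewrite ?inE; [|exact: mN|exact: JF].
  by apply: measurableX; [apply: measurableX|]; exact: measurable_itv.
rewrite N0.
have -> : leb3 ((J 0%R `*` J 1%R) `*` J 2%R) =
    ((@lebesgue_measure R \x @lebesgue_measure R)%E (J 0%R `*` J 1%R)
     * @lebesgue_measure R (J 2%R))%E.
  apply: product_measure1E; last exact: measurable_itv.
  by apply: measurableX; exact: measurable_itv.
have -> : (@lebesgue_measure R \x @lebesgue_measure R)%E (J 0%R `*` J 1%R) =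
    (@lebesgue_measure R (J 0%R) * @lebesgue_measure R (J 1%R))%E.
  by apply: product_measure1E; exact: measurable_itv.
rewrite !muJ -!EFinM lee_fin leNgt => /negP; apply.
by rewrite !mulr_gt0.
Qed.

Lemma sqnorm_ge0 H x : 0 <= sqnorm H x.
Proof. by apply: sumr_ge0 => k _; rewrite -expr2 sqr_ge0. Qed.

Lemma coordM_le_sqnorm H p q x : `|coord H p x * coord H q x| <= sqnorm H x.
Proof.
have c2 k : coord H k x ^+ 2 <= sqnorm H x.
  rewrite expr2 /sqnorm (bigD1 k)//= lerDl.
  by apply: sumr_ge0 => j _; rewrite -expr2 sqr_ge0.
have := c2 p; have := c2 q; rewrite ler_norml.
by move: (coord H p x) (coord H q x) (sqnorm H x) => a b c hb ha;
  apply/andP; split; nra.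
Qed.

(** The double cross product expands into four monomials, each linear in the curl and quadratic in
    [H]. The quadratic factor is integrable, so only the curl has to be bounded pointwise. *)
Lemma hall_flux_le H (L : R) i x : 0 <= L -> (forall k, `|coord (curl H) k x| <= L) ->
  `|coord (fun y => crossv (crossv (curl H y) (H y)) (H y)) i x| <= 4 * L * sqnorm H x.
Proof.
move=> L0 JL.
have P k p q : `|coord (curl H) k x * coord H p x * coord H q x| <= L * sqnorm H x.
  by rewrite -mulrA normrM; apply: ler_pM => //; exact: coordM_le_sqnorm.
have GH k q : `|coord (fun y => crossv (curl H y) (H y)) k x * coord H q x| <= 2 * (L * sqnorm H x).
  rewrite coord_crossv mulrBl (le_trans (ler_normB _ _))//.
  by rewrite mulr_natl mulr2n lerD.
rewrite coord_crossv (le_trans (ler_normB _ _))//.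
have -> : 4 * L * sqnorm H x = 2 * (L * sqnorm H x) + 2 * (L * sqnorm H x) by ring.
exact: lerD.
Qed.

(** This is the divergence of the weighted flux, in the form given by [weighted_energy_identity]. *)
Definition energy_integrand (alpha beta gamma s : R) H x : R :=
  \sum_(i < 3) energy_flux beta gamma H i x * pd i (weight s) x
  + (3 / 2 * beta - alpha) * (weight s x * sqnorm H x).

Lemma bump_bound (s a r : R) : s * a ^+ 2 = 1 -> 0 <= s -> `|r| <= a ->
  `|1 - s * (r * r)| <= 1.
Proof.
move=> sa s0 ra.
have h : 0 <= s * (r * r) <= 1.
  rewrite mulr_ge0 -?expr2 ?sqr_ge0//= -sa ler_wpM2l//.
  by move: ra; rewrite ler_norml => /andP[? ?]; nra.
by rewrite ler_norml; lra.
Qed.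

End EnergyBalance.

Section EnergyBalanceLimit.
Context {R : realType}.
Implicit Types (x : 'rV[R]_3) (H : 'rV[R]_3 -> 'rV[R]_3) (F : 'rV[R]_3 -> R).

Lemma energy_integrand_bound (alpha beta gamma s a L : R) H x :
  0 <= s -> 1 <= a -> s * a ^+ 2 = 1 -> 0 <= L ->
  (forall i, `|x 0 i| <= a) -> (forall k, `|coord (curl H) k x| <= L * a) ->
  `|energy_integrand alpha beta gamma s H x| <=
  (3 * (`|beta| + 8 * `|gamma| * L) + `|3 / 2 * beta - alpha|) * sqnorm H x.
Proof.
move=> s0 a1 sa L0 xa JL.
have a0 : 0 <= a by apply: le_trans a1.
have E0 := sqnorm_ge0 H x.
have bb k : `|1 - s * (x 0 k * x 0 k)| <= 1 by exact: (bump_bound s a).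
have w1 : `|weight s x| <= 1.
  by rewrite /weight !normrM !mulr_ile1 ?mulr_ge0.
have dw i : `|pd i (weight s) x| <= 2 * s * `|x 0 i|.
  rewrite pd_weight normrM normrN !normrM (ger0_norm s0) ger0_norm//.
  by rewrite ler_piMr ?mulr_ge0// mulr_ile1.
have fl i : `|energy_flux beta gamma H i x * pd i (weight s) x| <=
    (`|beta| + 8 * `|gamma| * L) * sqnorm H x.
  have X := hall_flux_le H (L * a) i x (mulr_ge0 L0 a0) JL.
  have fl1 : `|energy_flux beta gamma H i x| <=
      `|beta| / 2 * (`|x 0 i| * sqnorm H x) + `|gamma| * (4 * (L * a) * sqnorm H x).
    rewrite (le_trans (ler_normD _ _))// lerD//.
      by rewrite !normrM normfV normr_nat (ger0_norm E0).
    by rewrite normrM ler_wpM2l.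
  rewrite normrM (le_trans (ler_pM _ _ fl1 (dw i)))//.
  (* Regrouped so that the growing factors appear as [s * |x_i|^2] and [s * (a * |x_i|)], both at
     most [s * a^2 = 1]. The resulting bound is independent of [a]. *)
  have -> : (`|beta| / 2 * (`|x 0 i| * sqnorm H x) + `|gamma| * (4 * (L * a) * sqnorm H x)) *
     (2 * s * `|x 0 i|) =
     (`|beta| * (s * (`|x 0 i| * `|x 0 i|)) + 8 * `|gamma| * L * (s * (a * `|x 0 i|))) * sqnorm H x.
    by field.
  apply: ler_wpM2r => //; apply: lerD; apply: ler_piMr; rewrite ?mulr_ge0//.
    by rewrite -sa ler_wpM2l// expr2 ler_pM.
  by rewrite -sa ler_wpM2l// expr2 ler_wpM2l.
rewrite /energy_integrand [leRHS]mulrDl (le_trans (ler_normD _ _))// lerD//.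
  rewrite (le_trans (ler_norm_sum _ _ _))//.
  rewrite (le_trans (ler_sum _ (fun i _ => fl i)))//.
  by rewrite sum3 le_eqVlt; apply/orP; left; apply/eqP; ring.
rewrite normrM ler_wpM2l// normrM (ger0_norm E0).
by rewrite ler_piMl.
Qed.

Lemma energy_integrand_cvg (alpha beta gamma : R) (s : nat -> R) H x :
  s @ \oo --> (0 : R) ->
  energy_integrand alpha beta gamma (s n) H x @[n --> \oo] -->
  (3 / 2 * beta - alpha) * sqnorm H x.
Proof.
move=> s0.
have b1 k : 1 - s n * (x 0 k * x 0 k) @[n --> \oo] --> (1 : R).
  suff : 1 - s n * (x 0 k * x 0 k) @[n --> \oo] --> 1 - 0 * (x 0 k * x 0 k).
    by rewrite mul0r subr0.
  by apply: cvgB; [exact: cvg_cst | apply: cvgM => //; exact: cvg_cst].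
have w1 : weight (s n) x @[n --> \oo] --> (1 : R).
  suff : weight (s n) x @[n --> \oo] --> (1 * 1 * 1 : R) by rewrite !mulr1.
  by apply: cvgM => //; exact: cvgM.
have dw i : pd i (weight (s n)) x @[n --> \oo] --> (0 : R).
  under eq_fun do rewrite pd_weight.
  suff : - (2 * s n * x 0 i) * ((1 - s n * (x 0 (i + 1) * x 0 (i + 1))) *
      (1 - s n * (x 0 (i + 2) * x 0 (i + 2)))) @[n --> \oo] --> - (2 * 0 * x 0 i) * (1 * 1).
    by rewrite mulr0 mul0r oppr0 mul0r.
  apply: cvgM; last exact: cvgM.
  by apply: cvgN; apply: cvgM; [apply: cvgM => //|]; exact: cvg_cst.
rewrite /energy_integrand; under eq_fun do rewrite sum3.
have -> : (3 / 2 * beta - alpha) * sqnorm H x =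
  energy_flux beta gamma H 0 x * 0 + energy_flux beta gamma H 1 x * 0
  + energy_flux beta gamma H 2 x * 0 + (3 / 2 * beta - alpha) * (1 * sqnorm H x) by ring.
have fw i : energy_flux beta gamma H i x * pd i (weight (s n)) x @[n --> \oo] -->
   energy_flux beta gamma H i x * 0.
  by apply: cvgM => //; exact: cvg_cst.
apply: cvgD.
  by apply: cvgD => //; exact: cvgD.
apply: cvgM; first exact: cvg_cst.
by apply: cvgM => //; exact: cvg_cst.
Qed.

Lemma integral_weighted_flux (alpha beta gamma a : R) H : 0 < a ->
  C2field H -> profile_eq alpha beta gamma H ->
  (\int[leb3]_(p in box a)
     (energy_integrand alpha beta gamma (a ^- 2) H (vec3 p))%:E = 0)%E.
Proof.
move=> a0 CH eqH.
pose P i := fun y => weight (a ^- 2) y * energy_flux beta gamma H i y.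
have CP i : C1fun (P i).
  by apply: C1funM; [exact: C1fun_weight | exact: C1fun_energy_flux].
have P0 i (x : 'rV[R]_3) : `|x 0 i| = a -> P i x = 0.
  move=> xa; rewrite /P.
  have x1 : 1 - a ^- 2 * (x 0 i * x 0 i) = 0.
    have -> : x 0 i * x 0 i = a ^+ 2 by rewrite -xa real_normK ?num_real.
    by rewrite mulVf ?subrr// expf_neq0// gt_eqF.
  suff -> : weight (a ^- 2) x = 0 by rewrite mul0r.
  by rewrite /weight; move: i xa x1; apply: ord3P => _ ->; rewrite ?mulr0 ?mul0r.
transitivity (\int[leb3]_(p in box a) (\sum_(i < 3) (pd i (P i) (vec3 p))%:E))%E.
  apply: eq_integral => p _; rewrite sumEFin; congr EFin.
  by rewrite (weighted_energy_identity alpha).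
rewrite (integral_sum (measurable_box a)).
  by apply: big1 => i _; exact: (integral_box_pd _ i a a0 (CP i) (P0 i)).
by move=> i; apply: integrable_box; exact: C1fun_continuous_pd.
Qed.

Lemma continuous_energy_integrand (alpha beta gamma s : R) H : C2field H ->
  continuous (energy_integrand alpha beta gamma s H).
Proof.
move=> CH x.
have cf i := C1fun_continuous _ (C1fun_energy_flux beta gamma H i CH).
have cw i := C1fun_continuous_pd _ i (C1fun_weight s).
have cfw i : {for x, continuous (fun y => energy_flux beta gamma H i y * pd i (weight s) y)}.
  by apply: continuousM; [exact: cf | exact: cw].
have C0 k : C1fun (coord H k) by have [] := CH k.
have cE := C1fun_continuous _ (C1funM _ _ (C1fun_cst (3 / 2 * beta - alpha))
  (C1funM _ _ (C1fun_weight s) (C1fun_sqnorm H C0))).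
have -> : energy_integrand alpha beta gamma s H = fun y =>
    (energy_flux beta gamma H 0 y * pd 0 (weight s) y
    + energy_flux beta gamma H 1 y * pd 1 (weight s) y
    + energy_flux beta gamma H 2 y * pd 2 (weight s) y)
    + (3 / 2 * beta - alpha) * (weight s y * sqnorm H y).
  by apply/funext => y; rewrite /energy_integrand sum3.
exact: continuousD (continuousD (continuousD (cfw 0) (cfw 1)) (cfw 2)) (cE x).
Qed.

(** All box integrals are zero and converge to [3/2 beta - alpha] times the integral of [|H|^2], so
    one of these two factors vanishes. *)
Lemma energy_balance (alpha beta gamma K : R) H : C2field H ->
  (forall i j k x, `|pd i (pd j (coord H k)) x| <= K) ->
  (\int[leb3]_p (sqnorm H (vec3 p))%:E < +oo)%E ->
  profile_eq alpha beta gamma H ->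
  alpha = 3 / 2 * beta \/ forall x, sqnorm H x = 0.
Proof.
move=> CH HK L2 eqH.
have C0 k : C1fun (coord H k) by have [] := CH k.
have cE : continuous (sqnorm H) := C1fun_continuous _ (C1fun_sqnorm H C0).
have K0 : 0 <= K by apply: le_trans (HK 0 0 0 0).
have [M M0 HM] : exists2 M, 0 <= M & forall j k, `|pd j (coord H k) 0| <= M.
  exists (\sum_(j < 3) \sum_(k < 3) `|pd j (coord H k) 0|).
    by do 2 (apply: sumr_ge0 => ? _).
  move=> j k; rewrite (bigD1 j)//= (bigD1 k)//= -addrA lerDl addr_ge0//.
    by apply: sumr_ge0.
  by do 2 (apply: sumr_ge0 => ? _).
have dH j k x : `|pd j (coord H k) x| <= M + K * \sum_(i < 3) `|x 0 i|.
  apply: le_trans (linear_growth (pd j (coord H k)) K _ _ x) _.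
  - by move=> i y; apply: C1fun_derivable; have [] := CH k.
  - by move=> i y; exact: HK.
  - by rewrite lerD2r.
(* A component of the curl is a difference of two derivatives, each at most [M + 3 * K * a] on the
   box, hence at most [(M + 3 * K) * a] once [1 <= a]. *)
pose L := 2 * (M + 3 * K).
have L0 : 0 <= L by rewrite mulr_ge0 ?addr_ge0 ?mulr_ge0.
have JL (a : R) x : 1 <= a -> (forall i, `|x 0 i| <= a) ->
    forall k, `|coord (curl H) k x| <= L * a.
  move=> a1 xa k.
  have D j l : `|pd j (coord H l) x| <= M * a + K * (3 * a).
    rewrite (le_trans (dH j l x))// lerD//; first by rewrite ler_peMr.
    rewrite ler_wpM2l// sum3; have := xa 0; have := xa 1; have := xa 2; lra.
  rewrite coord_curl (le_trans (ler_normB _ _))//.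
  rewrite (le_trans (lerD (D _ _) (D _ _)))// /L le_eqVlt; apply/orP; left; apply/eqP.
  by ring.
pose c := 3 / 2 * beta - alpha.
pose C := 3 * (`|beta| + 8 * `|gamma| * L) + `|c|.
have C_ge0 : 0 <= C.
  by rewrite addr_ge0 ?mulr_ge0// addr_ge0// mulr_ge0// mulr_ge0.
pose a (n : nat) : R := n.+1%:R.
have a1 n : 1 <= a n by rewrite ler1n.
have a0 n : 0 < a n by rewrite ltr0n.
pose f n := (fun p => (energy_integrand alpha beta gamma (a n ^- 2) H (vec3 p))%:E) \_ (box (a n)).
have mE : measurable_fun setT (fun p => (sqnorm H (vec3 p))%:E).
  by apply/measurable_EFinP; exact: measurable_vec3.
have iE : leb3.-integrable setT (fun p => (sqnorm H (vec3 p))%:E).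
  apply/integrableP; split => //; under eq_integral => p _.
    rewrite /= ger0_norm ?sqnorm_ge0//.
  over.
  by [].
have s0 : a n ^- 2 @[n --> \oo] --> (0 : R).
  suff : harmonic n * harmonic n @[n --> \oo] --> (0 * 0 : R).
    rewrite mul0r; apply: cvg_trans; apply: near_eq_cvg; near=> n.
    by rewrite /harmonic /a expr2 invfM.
  by apply: cvgM; exact: cvg_harmonic.
have [] := @dominated_convergence _ _ R leb3 setT measurableT f
  (fun p => c%:E * (sqnorm H (vec3 p))%:E)%E (fun p => C%:E * (sqnorm H (vec3 p))%:E)%E.
- move=> n; apply/(measurable_restrictT _ (measurable_box (a n))).
  apply: measurable_funTS; apply/measurable_EFinP; apply: measurable_vec3.
  exact: continuous_energy_integrand.
- exact: measurable_funeM.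
- apply/aeW => p _; rewrite -EFinM.
  have := energy_integrand_cvg alpha beta gamma _ H (vec3 p) s0.
  move=> Qc; suff QcE : (energy_integrand alpha beta gamma (a n ^- 2) H (vec3 p))%:E
      @[n --> \oo] --> (c * sqnorm H (vec3 p))%:E.
    apply: cvg_trans QcE; apply: near_eq_cvg; near=> n.
    rewrite /f patchE ifT// inE; apply/boxP => i.
    have bn : (Num.bound (\sum_(i < 3) `|vec3 p 0 i|) <= n)%N.
      by near: n; exact: nbhs_infty_ge.
    apply: (@le_trans _ _ (\sum_(i < 3) `|vec3 p 0 i|)).
      by rewrite (bigD1 i)//= lerDl sumr_ge0.
    have /archi_boundP/ltW/le_trans : 0 <= \sum_(i < 3) `|vec3 p 0 i| by exact: sumr_ge0.
    by apply; rewrite ler_nat leqW.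
  by apply: cvg_EFin => //; exact: nearW.
- exact: integrableZl.
- apply/aeW => p n _; rewrite /f patchE; case: ifPn => [|_]; last first.
    by rewrite abse0 -EFinM lee_fin mulr_ge0// sqnorm_ge0.
  rewrite inE => /boxP pa; rewrite -EFinM lee_fin.
  apply: (@energy_integrand_bound _ _ _ _ (a n) L) => //.
  + by rewrite invr_ge0 exprn_ge0// ltW.
  + by rewrite mulVf// expf_neq0// gt_eqF.
  + exact: JL.
move=> _ _.
have -> : [sequence (\int[leb3]_p f n p)%E]_n = fun=> 0%E.
  by apply/funext => n /=; rewrite /f -integral_mkcond integral_weighted_flux.
move=> /(cvg_unique (@ereal_hausdorff R) (cvg_cst _))/esym.
rewrite integralZl// => /eqP; rewrite mule_eq0 eqe => /orP[/eqP c0|/eqP E0].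
  by left; apply/esym/eqP; rewrite -subr_eq0; apply/eqP.
right.
have [+ _] := ae_eq_integral_abs leb3 measurableT mE.
under eq_integral => p _ do rewrite /= ger0_norm ?sqnorm_ge0//.
move=> /(_ E0) aeE.
have E_le0 : {ae leb3, forall p, sqnorm H (vec3 p) <= 0}.
  by apply: filterS aeE => p /(_ I) /= [->].
by move=> x; apply/eqP; rewrite eq_le sqnorm_ge0 (ae_vec3_le _ _ cE E_le0).
Unshelve. all: by end_near. Qed.

End EnergyBalanceLimit.

(** * Self-similar scaling *)

Section Scaling.
Context {R : realType}.
Implicit Types (x : 'rV[R]_3) (H : 'rV[R]_3 -> 'rV[R]_3).

(** Exchanging the sums isolates, for each component of the field, its radial derivative times [r],
    to which the Euler relation applies. *)
Lemma radial_sum (r : R) (X h : 'I_3 -> R) (D : 'I_3 -> 'I_3 -> R) :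
  r ^+ 3 * (\sum_(i < 3) X i * (2 * \sum_(k < 3) h k * D i k)) =
  r ^+ 2 * \sum_(k < 3) (r * (2 * (h k * \sum_(i < 3) X i * D i k))).
Proof.
transitivity (r ^+ 3 * \sum_(i < 3) \sum_(k < 3) 2 * (h k * (X i * D i k))).
  by congr (_ * _); apply: eq_bigr => i _; rewrite !mulr_sumr; apply: eq_bigr => k _; ring.
rewrite exchange_big exprSr -mulrA; congr (_ * _); rewrite mulr_sumr.
by apply: eq_bigr => k _; rewrite -!mulr_sumr.
Qed.

Lemma linear_profile_eq (alpha beta K : R) H : C2field H ->
  (forall i j k x, `|pd i (pd j (coord H k)) x| <= K) ->
  (\int[leb3]_p (sqnorm H (vec3 p))%:E < +oo)%E ->
  (exists x, sqnorm H x <> 0) ->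
  profile_eq alpha beta 0 H -> alpha = 0 /\ beta = 0.
Proof.
move=> CH HK L2 [x0 Hx0] eqH.
have C0 k : C1fun (coord H k) by have [] := CH k.
have CE := C1fun_sqnorm H C0.
have [ab|H0] := energy_balance alpha beta 0 K H CH HK L2 eqH; last by have := H0 x0.
have [b0|b0] := eqVneq beta 0; first by rewrite ab b0 mulr0.
(* Homogeneity of degree -3/2 makes [phi] constant along the ray. It vanishes at [r = 0] and equals
   [sqnorm H x0], which is nonzero, at [r = 1]. *)
pose phi (r : R) := r ^+ 3 * sqnorm H (r *: x0).
have dphi (r : R) : is_derive r 1 phi 0.
  have dE := is_derive_ray (sqnorm H) x0 r CE.
  rewrite /phi; apply: is_derive_eq.
  have Euler k : r * (\sum_(i < 3) x0 0 i * pd i (coord H k) (r *: x0))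
     = - (3 / 2) * coord H k (r *: x0).
    have := eqH (r *: x0) k; rewrite ab mul0r addr0 => eqk.
    apply: (mulfI b0); apply/eqP; rewrite -subr_eq0; apply/eqP; rewrite -[RHS]eqk.
    have -> : \sum_(i < 3) (r *: x0) 0 i * pd i (coord H k) (r *: x0) =
       r * \sum_(i < 3) x0 0 i * pd i (coord H k) (r *: x0).
      by rewrite mulr_sumr; apply: eq_bigr => i _; rewrite mxE mulrA.
    by move: (coord H k (r *: x0)) (\sum_(i < 3) _) => h S; field.
  have Z k : r * (2 * (coord H k (r *: x0) * (\sum_(i < 3) x0 0 i * pd i (coord H k) (r *: x0))))
     = - 3 * (coord H k (r *: x0) * coord H k (r *: x0)).
    by rewrite mulrCA (mulrCA r) Euler; field.
  have -> : r ^+ 3 *: (\sum_(i < 3) x0 0 i * pd i (sqnorm H) (r *: x0)) =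
      r ^+ 2 * \sum_(k < 3) (r * (2 * (coord H k (r *: x0) *
         (\sum_(i < 3) x0 0 i * pd i (coord H k) (r *: x0))))).
    rewrite [LHS]/GRing.scale /=; under eq_bigr do rewrite (pd_sqnorm _ _ _ C0).
    exact: radial_sum.
  under eq_bigr do rewrite Z.
  rewrite -mulr_sumr /sqnorm.
  by rewrite !sum3 /GRing.scale /=; ring.
have := is_derive_0_is_cst 1 0 dphi.
by rewrite /phi expr1n mul1r scale1r expr0n /= mul0r.
Qed.

Lemma pd_dilation (f : 'rV[R]_3 -> R) (m l : R) i :
  (forall x, derivable f x (delta_mx 0 i)) ->
  pd i (fun x => m * f (l *: x)) = fun x => (m * l) * pd i f (l *: x).
Proof.
move=> df; apply/funext => x.
have d := is_derive_dilation f i l x (df (l *: x)).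
rewrite /pd (@deriveZ _ _ _ (fun y => f (l *: y)) m); last by case: d.
by rewrite derive_val -mulrA.
Qed.

Section Dilation.
Variables (H : 'rV[R]_3 -> 'rV[R]_3) (CH : C2field H) (m l : R).

Let B x := m *: H (l *: x).

Lemma coord_dilation k : coord B k = fun x => m * coord H k (l *: x).
Proof. by apply/funext => x; rewrite /Defs.coord mxE. Qed.

Lemma hessian_dilation i j k x :
  pd i (pd j (coord B k)) x = m * l * l * pd i (pd j (coord H k)) (l *: x).
Proof.
have [C0 C1] := CH k.
rewrite coord_dilation pd_dilation; last by move=> y; exact: C1fun_derivable.
by rewrite pd_dilation// => y; exact: C1fun_derivable.
Qed.

Lemma curl_dilation k : coord (curl B) k = fun x => m * l * coord (curl H) k (l *: x).
Proof.
apply/funext => x; rewrite !coord_curl !coord_dilation !pd_dilation ?mulrBr//.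
all: by move=> y; apply: C1fun_derivable; apply: (CH _).1.
Qed.

Lemma hall_dilation k x :
  coord (curl (fun y => crossv (curl B y) (B y))) k x =
  m ^+ 2 * l ^+ 2 * coord (curl (fun y => crossv (curl H y) (H y))) k (l *: x).
Proof.
have E j : coord (fun y => crossv (curl B y) (B y)) j =
   fun y => m * l * m * coord (fun z => crossv (curl H z) (H z)) j (l *: y).
  apply/funext => y; rewrite !coord_crossv !curl_dilation !coord_dilation; ring.
have C0 j : C1fun (coord H j) by have [] := CH j.
have CG := C1fun_crossv (curl H) H (C1fun_curl H CH) C0.
rewrite !coord_curl !E !pd_dilation; first ring.
all: by move=> y; apply: C1fun_derivable.
Qed.

End Dilation.

End Scaling.

(** * From the evolution equation to the profile equation *)

Section ClassicalSolutions.
Context {R : realType}.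
Implicit Types (J : set R) (B : R -> 'rV[R]_3 -> 'rV[R]_3).

Lemma continuous_slab_slice J (g : R -> 'rV[R]_3 -> R) (t : R) :
  continuous_slab J g -> J t -> continuous (g t).
Proof.
move=> /subspace_continuousP cg Jt x A /(cg (t, x)) /= Ag.
have {Ag} : within (J `*` setT) (nbhs (t, x)) ((fun p => g p.1 p.2) @^-1` A) by exact: Ag.
move=> [[P Q] /= [Pt Qx] PQ].
suff : nbhs x ((g t) @^-1` A) by [].
apply: filterS Qx => y Qy; apply: (PQ (t, y)) => //; split => //=.
exact: nbhs_singleton.
Qed.

Lemma classical_C2field J B t : classical_on J B -> J t -> C2field (B t).
Proof.
move=> [_ cl] Jt k; have [cb cl2] := cl k; split.
  split; first exact: continuous_slab_slice cb Jt.
  move=> j; have [dj [cj _]] := cl2 j; split; first exact: dj.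
  exact: continuous_slab_slice cj Jt.
move=> j; have [dj [cj cl3]] := cl2 j.
split; first exact: continuous_slab_slice cj Jt.
move=> i; have [dij cij] := cl3 i; split; first exact: dij.
exact: continuous_slab_slice cij Jt.
Qed.

(** The evolution equation is taken at [x = y / l t] and multiplied by [l t], which turns [x] into
    [y]. This form, free of division by [m t], stays meaningful when [m t = 0]. *)
Lemma profile_eq_of_solution J B H (l m : R -> R) (t dl dm : R) :
  (forall s, J s -> forall x, B s x = m s *: H (l s *: x)) ->
  C2field H -> electron_mhd J B -> classical_on J B -> interior J t ->
  is_derive t 1 l dl -> is_derive t 1 m dm -> l t != 0 ->
  profile_eq (l t * dm) (m t * dl) (m t ^+ 2 * l t ^+ 3) H.
Proof.
move=> BE CH [mhd _] [dB _] Jt dlt dmt lt0 y k.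
have C0 j : C1fun (coord H j) by have [] := CH j.
pose x := (l t)^-1 *: y.
have xy : l t *: x = y by rewrite /x scalerA mulfV// scale1r.
have := mhd t Jt x.
have -> : B t = fun z => m t *: H (l t *: z).
  by apply/funext => z; rewrite BE//; exact: interior_subset.
move=> /(congr1 (fun v : 'rV[R]_3 => v 0 k)); rewrite [LHS]mxE [RHS]mxE.
rewrite -[curl _ x 0 k]/(coord (curl (fun z => crossv (curl (fun x => m t *: H (l t *: x)) z)
   (m t *: H (l t *: z)))) k x) (hall_dilation H CH).
rewrite derive1E derive_mx ?mxE; last exact: dB.
have -> : 'D_1 (fun s => B s x 0 k) t =
    m t * (dl * \sum_(i < 3) x 0 i * pd i (coord H k) y) + coord H k y * dm.
  have dr := is_derive_time_dilation (coord H k) x l t dl (C0 k) dlt.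
  have -> : 'D_1 (fun s => B s x 0 k) t = 'D_1 (fun s => m s * coord H k (l s *: x)) t.
    (* The self-similar formula holds only on [J]; since [t] is interior, it holds near [t] and may
       be differentiated. *)
    apply: near_eq_derive.
    near=> s; rewrite BE ?mxE//.
    by near: s.
  have := @is_deriveM _ _ m (fun s => coord H k (l s *: x)) t 1 _ _ dmt dr.
  move=> /(@derive_val _ _ _ _ _ _ _) ->; rewrite xy /GRing.scale /=; ring.
rewrite xy => eqt.
have -> : \sum_(i < 3) y 0 i * pd i (coord H k) y =
    l t * \sum_(i < 3) x 0 i * pd i (coord H k) y.
  by rewrite mulr_sumr; apply: eq_bigr => i _; rewrite mulrA -xy !mxE.
apply: etrans (mulr0 (l t)); rewrite -[X in _ = _ * X]eqt.
by move: (\sum_(i < 3) _) (coord _ k y) (coord _ k y) => S N h; ring.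
Unshelve. all: by end_near. Qed.

End ClassicalSolutions.

(** * The scaling ODE *)

Section ScalingODE.
Context {R : realType}.

Lemma is_derive_0_segment (f : R -> R) (u v : R) :
  (forall x, Num.min u v < x < Num.max u v -> is_derive x 1 f 0) ->
  (forall x, Num.min u v <= x <= Num.max u v -> {for x, continuous f}) ->
  f u = f v.
Proof.
wlog uv : u v / u <= v => [H d0 cf|].
  have [uv|vu] := leP u v; first exact: H.
  by apply/esym; apply: H; rewrite ?(ltW vu)// 1?minC 1?maxC.
rewrite min_l// max_r// => d0 cf.
have cw : {within `[u, v], continuous f}.
  by apply: continuous_in_subspaceT => x; rewrite inE /= in_itv /=; exact: cf.
have d0' x : x \in `]u, v[%R -> is_derive x 1 f 0 by rewrite in_itv /=; exact: d0.
have [c _] := @MVT_segment R f (fun=> 0) u v uv d0' cw.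
by rewrite mul0r => /eqP; rewrite subr_eq0 => /eqP.
Qed.

Lemma is_derive_inv (g : R -> R) (x dg : R) : g x != 0 ->
  is_derive x 1 g dg -> is_derive x 1 (fun y => (g y)^-1) (- (g x) ^- 2 * dg).
Proof.
by move=> gx dgx; apply: DeriveDef; [exact: derivableV | rewrite deriveV// derive_val].
Qed.

Lemma is_derive_quotient (f g : R -> R) (x df dg : R) : g x != 0 ->
  is_derive x 1 f df -> is_derive x 1 g dg ->
  is_derive x 1 (fun y => f y / g y) ((df * g x - f x * dg) / g x ^+ 2).
Proof.
move=> gx dfx dgx; have dgV := is_derive_inv g x dg gx dgx.
have -> : (df * g x - f x * dg) / g x ^+ 2 = f x * (- (g x) ^- 2 * dg) + (g x)^-1 * df.
  by field.
exact: (is_deriveM dfx dgV).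
Qed.

Lemma continuous_exprn_comp (f : R -> R) (n : nat) (t : R) :
  {for t, continuous f} -> {for t, continuous (fun s => f s ^+ n)}.
Proof. by move=> cf; apply: (cvg_comp f (fun x => x ^+ n) cf); exact: exprn_continuous. Qed.

Section Invariants.
Variables (l m : R -> R) (c t0 p q : R).
Hypothesis cl : forall t, p <= t <= q -> {for t, continuous l}.
Hypothesis cm : forall t, p <= t <= q -> {for t, continuous m}.
Hypothesis dl : forall t, p < t < q -> l t != 0 -> m t != 0 ->
  is_derive t 1 l (2 * c * (m t * l t ^+ 3)).
Hypothesis dm : forall t, p < t < q -> l t != 0 -> m t != 0 ->
  is_derive t 1 m (3 * c * (m t ^+ 2 * l t ^+ 2)).
Hypotheses (pq : p <= t0 <= q) (l0 : l t0 = 1) (m0 : m t0 = 1).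

(** Positivity belongs to the invariant because the rates are known only where [l] and [m] do not
    vanish. *)
Let inv t := [/\ 0 < l t, 0 < m t, m t ^+ 2 = l t ^+ 3 &
  m t * l t ^+ 2 * (1 - 7 * c * (t - t0)) = 1].

(* The conditions of inv as a single equation, whose solutions form a closed set. *)
Let defect t := `|m t ^+ 2 - l t ^+ 3| +
  `|m t * l t ^+ 2 * (1 - 7 * c * (t - t0)) - 1| + (`|m t| - m t).

(** The open conditions follow from the closed ones: the last equation of [inv] makes [l] and [m]
    nonzero, [|m| = m] then gives [0 < m], and [l^3 = m^2 > 0] gives [0 < l]. *)
Let defectP t : defect t = 0 <-> inv t.
Proof.
split=> [d0|[lt0 mt0 ml e1]]; last first.
  by rewrite /defect ml e1 !subrr !normr0 gtr0_norm// subrr !addr0.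
have h1 := normr_ge0 (m t ^+ 2 - l t ^+ 3).
have h2 := normr_ge0 (m t * l t ^+ 2 * (1 - 7 * c * (t - t0)) - 1).
have h3 : 0 <= `|m t| - m t by rewrite subr_ge0 ler_norm.
have {h1 h2 h3} [e1 e2 e3] : [/\ `|m t ^+ 2 - l t ^+ 3| = 0,
    `|m t * l t ^+ 2 * (1 - 7 * c * (t - t0)) - 1| = 0 & `|m t| - m t = 0].
  by move: d0; rewrite /defect; split; lra.
move: e1 e2 => /normr0_eq0/eqP + /normr0_eq0/eqP; rewrite !subr_eq0 => /eqP e1 /eqP e2.
have n0 : m t * l t ^+ 2 != 0.
  by apply/negP => /eqP z; move: e2; rewrite z mul0r => /eqP; rewrite eq_sym oner_eq0.
move: n0; rewrite mulf_eq0 expf_eq0 /= negb_or => /andP[mn ln].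
have mp : 0 < m t.
  by rewrite lt_neqAle eq_sym mn/=; move: e3 => /eqP; rewrite subr_eq0 => /eqP <-.
split => //.
have : 0 < l t ^+ 3 by rewrite -e1 exprn_gt0.
by rewrite exprS pmulr_lgt0// exprn_even_gt0.
Qed.

Let defect_continuous t : p <= t <= q -> {for t, continuous defect}.
Proof.
move=> tpq; have clt := cl t tpq; have cmt := cm t tpq.
have cn (f : R -> R) : {for t, continuous f} -> {for t, continuous (fun s => `|f s|)}.
  by move=> cf; apply: (cvg_comp f Num.norm cf); exact: norm_continuous.
have ca : {for t, continuous (fun s : R => 1 - 7 * c * (s - t0))}.
  apply: cvgB; first exact: cvg_cst.
  by apply: cvgM; [exact: cvg_cst | apply: cvgB; [exact: cvg_id | exact: cvg_cst]].
apply: cvgD; [apply: cvgD|].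
- by apply: cn; apply: cvgB; exact: continuous_exprn_comp.
- apply: cn; apply: cvgB; last exact: cvg_cst.
  by apply: cvgM => //; apply: cvgM => //; exact: continuous_exprn_comp.
- by apply: cvgB => //; exact: cn.
Qed.

(** While [l] and [m] stay positive there are two first integrals. One is [m^2 / l^3], as numerator
    and denominator both have logarithmic derivative [6 c m l^2]. The other is
    [1 / (m l^2) + 7 c t], as [(m l^2)' = 7 c (m l^2)^2]. *)
Let inv_near t : p <= t <= q -> inv t -> \forall s \near t, p <= s <= q -> inv s.
Proof.
move=> tpq [lt0 mt0 ml e1].
have := cl t tpq _ (lt_nbhsr lt0); have := cm t tpq _ (lt_nbhsr mt0).
rewrite !nbhs_simpl => /nbhs_ballP[e1' /= e10 pm] /nbhs_ballP[e2' /= e20 pl].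
apply/nbhs_ballP; exists (Num.min e1' e2'); first by rewrite /= lt_min e10.
move=> s; rewrite /ball /= lt_min => /andP[s1 s2] spq.
have seg x : Num.min t s <= x <= Num.max t s ->
    [/\ p <= x <= q, 0 < l x & 0 < m x].
  have [ts|st] := leP t s => /andP[x1 x2].
    have d e : `|t - s| < e -> ball t e x.
      by rewrite /ball /= !ltr_norml; lra.
    by split; [lra | exact/pl/d | exact/pm/d].
  have d e : `|t - s| < e -> ball t e x.
    by rewrite /ball /= !ltr_norml; lra.
  by split; [lra | exact/pl/d | exact/pm/d].
have sego x : Num.min t s < x < Num.max t s -> p < x < q.
  by have [ts|st] := leP t s => /andP[x1 x2]; lra.
have segW x : Num.min t s < x < Num.max t s -> Num.min t s <= x <= Num.max t s.
  by move=> /andP[/ltW-> /ltW->].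
have I1 : m t ^+ 2 / l t ^+ 3 = m s ^+ 2 / l s ^+ 3.
  apply: (@is_derive_0_segment (fun x => m x ^+ 2 / l x ^+ 3)) => x xs.
    have [_ lx mx] := seg _ (segW _ xs). have xpq := sego _ xs.
    have dlx := dl x xpq (lt0r_neq0 lx) (lt0r_neq0 mx).
    have dmx := dm x xpq (lt0r_neq0 lx) (lt0r_neq0 mx).
    have lx3 : l x ^+ 3 != 0 by rewrite expf_neq0// lt0r_neq0.
    have dl3 : is_derive x 1 (fun y => l y ^+ 3) (3 * l x ^+ 2 * (2 * c * (m x * l x ^+ 3))).
      exact: (is_deriveX 3 dlx).
    have dm2 : is_derive x 1 (fun y => m y ^+ 2) (2 * m x * (3 * c * (m x ^+ 2 * l x ^+ 2))).
      by have := is_deriveX 2 dmx; rewrite expr1.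
    have := is_derive_quotient (fun y => m y ^+ 2) (fun y => l y ^+ 3) x _ _ lx3 dm2 dl3.
    by congr (is_derive _ _ _ _); field; rewrite lt0r_neq0.
  have [xpq lx mx] := seg _ xs.
  apply: cvgM; first by apply: continuous_exprn_comp; exact: cm.
  by apply: cvgV; [rewrite expf_neq0// lt0r_neq0 | apply: continuous_exprn_comp; exact: cl].
have I2 : (m t * l t ^+ 2)^-1 + 7 * c * t = (m s * l s ^+ 2)^-1 + 7 * c * s.
  apply: (@is_derive_0_segment (fun x => (m x * l x ^+ 2)^-1 + 7 * c * x)) => x xs.
    have [_ lx mx] := seg _ (segW _ xs). have xpq := sego _ xs.
    have dlx := dl x xpq (lt0r_neq0 lx) (lt0r_neq0 mx).
    have dmx := dm x xpq (lt0r_neq0 lx) (lt0r_neq0 mx).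
    have gx : m x * l x ^+ 2 != 0 by rewrite mulf_neq0 ?expf_neq0// lt0r_neq0.
    have dg : is_derive x 1 (fun y => m y * l y ^+ 2) (m x * (2 * l x * (2 * c * (m x * l x ^+ 3)))
        + l x ^+ 2 * (3 * c * (m x ^+ 2 * l x ^+ 2))).
      by have := is_deriveM dmx (is_deriveX 2 dlx); rewrite expr1.
    have d7 : is_derive x 1 (fun y : R => 7 * c * y) (7 * c).
      by apply: is_derive_eq; rewrite [LHS]mulr1.
    have -> : 0 = - (m x * l x ^+ 2) ^- 2 * (m x * (2 * l x * (2 * c * (m x * l x ^+ 3)))
        + l x ^+ 2 * (3 * c * (m x ^+ 2 * l x ^+ 2))) + 7 * c.
      by field; rewrite !lt0r_neq0.
    exact: (is_deriveD (is_derive_inv (fun y => m y * l y ^+ 2) x _ gx dg) d7).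
  have [xpq lx mx] := seg _ xs.
  apply: cvgD; last by apply: cvgM; [exact: cvg_cst | exact: cvg_id].
  apply: cvgV; first by rewrite mulf_neq0 ?expf_neq0// lt0r_neq0.
  by apply: cvgM; [exact: cm | apply: continuous_exprn_comp; exact: cl].
have [_ ls ms] : [/\ p <= s <= q, 0 < l s & 0 < m s].
  by apply: seg; rewrite ge_min le_max !lexx !orbT.
split => //.
  move: I1; rewrite ml divff ?expf_neq0 ?lt0r_neq0// => /esym/divr1_eq.
  by [].
have gs : m s * l s ^+ 2 != 0 by rewrite lt0r_neq0// mulr_gt0// exprn_gt0.
have gt : (m t * l t ^+ 2)^-1 = 1 - 7 * c * (t - t0).
  have gt : m t * l t ^+ 2 != 0 by rewrite lt0r_neq0// mulr_gt0// exprn_gt0.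
  by apply: (mulfI gt); rewrite mulfV// e1.
have -> : 1 - 7 * c * (s - t0) = (m s * l s ^+ 2)^-1.
  by move: I2; rewrite gt => I2; lra.
by rewrite mulfV.
Qed.

(** The times satisfying [inv] form a nonempty subset of a connected interval, relatively open by
    [inv_near] and relatively closed as the zero set of [defect]. *)
Lemma scaling_ode_invariants t : p <= t <= q -> inv t.
Proof.
have inv0 : inv t0 by split; rewrite ?l0 ?m0 ?expr1n ?subrr ?mulr0 ?subr0 ?mulr1.
have : connected (`[p, q]%classic : set R).
  by apply/connected_intervalP; exact: interval_is_interval.
move=> /(_ [set t | p <= t <= q /\ inv t]) E.
suff /seteqP[_ +] : [set t | p <= t <= q /\ inv t] = `[p, q]%classic.
  by move=> S tpq; have [] := S t; rewrite /= ?in_itv.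
apply: E.
- by exists t0.
- exists (interior [set s | p <= s <= q -> inv s]); first exact: open_interior.
  apply/seteqP; split => [s [spq si]|s [/= spq /interior_subset /= si]] /=.
    by split; [rewrite in_itv | exact: inv_near].
  by move: spq; rewrite in_itv /= => spq; split => //; exact: si.
- exists [set s | p <= s <= q /\ inv s]; last first.
    by apply/seteqP; split => [s [spq si]|s [_ ]] //=; rewrite in_itv.
  rewrite -openC openE => s /= ns; rewrite /interior.
  have [spq|spq] := boolP (p <= s <= q).
    have d0 : defect s != 0.
      by apply/eqP => /defectP si; apply: ns.
    have dn : 0 < `|defect s| by rewrite normr_gt0.
    have := defect_continuous s spq => /cvgrPdist_lt /(_ _ dn); apply: filterS => r.
    by move=> h [_ /defectP d]; move: h; rewrite d subr0 ltxx.
  have : nbhs s (~` `[p, q]%classic).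
    apply: open_nbhs_nbhs; split; last by rewrite /= in_itv; exact/negP.
    by rewrite openC; exact: interval_closed.
  by apply: filterS => r rpq [rpq' _]; apply: rpq; rewrite /= in_itv.
Qed.

End Invariants.

(** The curve [m^2 = l^3] is parametrized by [l = u^2], [m = u^3], and then
    [m l^2 = u^7 = 1 / d]. *)
Lemma power_form (l m d : R) : 0 < l -> 0 < m -> 0 < d -> m ^+ 2 = l ^+ 3 ->
  m * l ^+ 2 * d = 1 -> l = d `^ (- (2 / 7)) /\ m = d `^ (- (3 / 7)).
Proof.
move=> l0 m0 d0 ml e1.
pose u := d `^ (- (1 / 7)).
have u0 : 0 < u by rewrite powR_gt0.
have uX n : u ^+ n = d `^ (- (n%:R / 7)).
  by rewrite -powR_mulrn ?ltW// -powRrM; congr (_ `^ _); field.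
have u7 : u ^+ 7 * d = 1.
  by rewrite uX divff// powR_inv1 ?ltW// mulVf// gt_eqF.
have l7 : l ^+ 7 = (u ^+ 2) ^+ 7.
  have dn : d ^+ 2 != 0 by rewrite expf_neq0// gt_eqF.
  apply: (mulIf dn).
  have -> : l ^+ 7 * d ^+ 2 = m ^+ 2 * l ^+ 4 * d ^+ 2 by rewrite ml; ring.
  have -> : m ^+ 2 * l ^+ 4 * d ^+ 2 = (m * l ^+ 2 * d) ^+ 2 by ring.
  have -> : (u ^+ 2) ^+ 7 * d ^+ 2 = (u ^+ 7 * d) ^+ 2 by ring.
  by rewrite e1 u7.
have lu : l = u ^+ 2.
  by apply: (@pexpIrn R 7) => //; rewrite ?nnegrE ?exprn_ge0 ?ltW.
have mu : m = u ^+ 3.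
  apply: (@pexpIrn R 2) => //; rewrite ?nnegrE ?exprn_ge0 ?ltW//.
  by rewrite ml lu; ring.
by rewrite lu mu !uX.
Qed.

End ScalingODE.

(** * Norms and blow-up *)

Section NormBounds.
Context {R : realType}.
Implicit Types (g : 'rV[R]_3 -> R) (B : R -> 'rV[R]_3 -> 'rV[R]_3).

(** [Lnorm] with exponent [+oo] unfolds to an essential supremum only when the whole space has
    positive measure. *)
Lemma leb3_setT_gt0 :
  (0 < leb3 [set: measurableTypeR R * measurableTypeR R * measurableTypeR R] :> \bar R)%E.
Proof.
rewrite lt0e measure_ge0 andbT; apply/eqP => T0.
have aeF : {ae leb3, forall p, (fun _ : 'rV[R]_3 => 1 : R) (vec3 p) <= 0}.
  by exists setT; split => //; exact: measurableT.
have c1 := C1fun_continuous _ (@C1fun_cst R 1).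
have := ae_vec3_le _ 0 c1 aeF 0.
by rewrite ler10.
Qed.

(** An almost everywhere bound on [g] holds everywhere for a continuous function below [g]. In the
    application [g] is the Hessian norm and [f] a single second derivative. *)
Lemma Linfty_bounded g : (Lp_norm +oo g < +oo)%E ->
  exists2 K, 0 <= K & forall f : 'rV[R]_3 -> R, continuous f ->
    (forall x, `|f x| <= `|g x|) -> forall x, `|f x| <= K.
Proof.
rewrite /Lp_norm unlock leb3_setT_gt0 => gfin.
pose S := ess_sup leb3 (abse \o (fun q => (g (vec3 q))%:E)).
have gS : {ae leb3, forall q, (`|(g (vec3 q))%:E| <= S)%E} by exact: ess_sup_ge.
exists (`|fine S|) => // f cf fg x; apply: le_trans (ler_norm _).
have nf : continuous (fun x => `|f x|).
  by move=> y; apply: (cvg_comp f Num.norm); [exact: cf | exact: norm_continuous].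
move: x; apply: (ae_vec3_le (fun x => `|f x|)) => //.
have [N [mN N0 NS]] := gS; exists N; split => //.
apply: subset_trans NS; apply: subsetC => q /=; rewrite -/S in gfin.
case: S {gS} gfin => [r _|//|_] /=; last by rewrite leeNy_eq.
by rewrite lee_fin; apply: le_trans.
Qed.

Lemma Linfty_le g (K : R) : 0 <= K -> (forall x, `|g x| <= K) -> (Lp_norm +oo g <= K%:E)%E.
Proof.
move=> K0 gK; rewrite /Lp_norm unlock leb3_setT_gt0.
by apply/ess_supP; apply/aeW => q /=; rewrite lee_fin.
Qed.

Lemma sqnorm_integral_lty (H : 'rV[R]_3 -> 'rV[R]_3) :
  (Lp_norm 2%:E (fun x => enorm (H x)) < +oo)%E ->
  (\int[leb3]_p (sqnorm H (vec3 p))%:E < +oo)%E.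
Proof.
rewrite /Lp_norm => Hfin.
have two0 : (2 : R) != 0 by rewrite pnatr_eq0.
have := @poweR_Lnorm _ _ R leb3 (fun q => (enorm (H (vec3 q)))%:E) 2 two0.
have -> : (\int[leb3]_p (sqnorm H (vec3 p))%:E =
   \int[leb3]_p (`|(enorm (H (vec3 p)))%:E| `^ 2))%E.
  apply: eq_integral => p _; rewrite /= powR_mulrn// real_normK ?num_real//.
  rewrite /enorm sqr_sqrtr; last by apply: sumr_ge0 => k _; exact: sqr_ge0.
  by [].
move=> <-.
by rewrite poweR_lty.
Qed.

(** Times of infinite energy form a null set, which cannot contain the interval []u, v[]. *)
Lemma bounded_energy_finite (T : R) B (u v : R) : bounded_energy T B ->
  0 <= u -> u < v -> v <= T ->
  exists2 t, u < t < v & (Lp_norm 2%:E (fun x => enorm (B t x)) < +oo)%E.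
Proof.
rewrite /bounded_energy => S_fin u0 uv vT.
pose f t := Lp_norm 2%:E (fun x => enorm (B t x)).
have [N [mN N0 fN]] := ess_sup_ge (mrestr (@lebesgue_measure R) (measurable_itv `]0%R, T[)) f.
apply: contrapT => nt.
have uvN : `]u, v[ `<=` N `&` `]0, T[.
  move=> t /=; rewrite !in_itv /= => tuv; split; last by lra.
  apply: fN => /= ft; apply: nt; exists t => //.
  exact: le_lt_trans ft S_fin.
have : (@lebesgue_measure R `]u, v[ <= @lebesgue_measure R (N `&` `]0%R, T[))%E.
  by apply: le_measure => //; rewrite ?inE//; exact: measurableI.
have -> : @lebesgue_measure R (N `&` `]0%R, T[) = 0%E by exact: N0.
rewrite lebesgue_measure_itv /= lte_fin uv.
by rewrite -EFinD lee_fin; lra.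
Qed.

End NormBounds.

Section NonmeasurableIntegral.
Context d (X : measurableType d) (R : realType).
Variable mu : {measure set X -> \bar R}.
Local Open Scope ereal_scope.

(* The integral of a nonnegative function is a supremum over simple functions
   below it, hence monotone without measurability. *)
Lemma ge0_le_integral_nonmeas (D : set X) (f g : X -> \bar R) :
  (forall x, D x -> 0 <= f x) -> (forall x, D x -> f x <= g x) ->
  \int[mu]_(x in D) f x <= \int[mu]_(x in D) g x.
Proof.
move=> f0 fg.
have g0 x : D x -> 0 <= g x by move=> Dx; exact: le_trans (f0 _ Dx) (fg _ Dx).
rewrite !ge0_integralE//; apply: le_ereal_sup => _ [h hf <-].
exists h => // x; apply: le_trans (hf x) _; rewrite !patchE.
by case: ifPn => // xD; apply: fg; rewrite inE in xD.
Qed.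

End NonmeasurableIntegral.

Section HessianIntegral.
Context {R : realType}.
Implicit Types (B : R -> 'rV[R]_3 -> 'rV[R]_3).

Lemma int_D2_Linfty_le B (t G : R) : 0 <= t -> 0 <= G ->
  (forall s, 0 <= s <= t -> (Lp_norm +oo (hessian_norm (B s)) <= G%:E)%E) ->
  (int_D2_Linfty B t <= (G * t)%:E)%E.
Proof.
move=> t0 G0 BG.
have -> : (G * t)%:E = (\int[@lebesgue_measure R]_(s in `[0%R, t]) (cst G%:E) s)%E.
  have -> : (\int[@lebesgue_measure R]_(s in `[0%R, t]) (cst G%:E) s)%E =
      (G%:E * @lebesgue_measure R `[0%R, t])%E by exact: integral_cst.
  rewrite lebesgue_measure_itv /= lte_fin.
  have [t1|t1] := ltP 0 t; first by rewrite sube0 EFinM.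
  by have -> : t = 0 by lra; rewrite mulr0 mule0.
apply: ge0_le_integral_nonmeas => s; first by move=> _; exact: Lnorm_ge0.
by rewrite /= in_itv /=; exact: BG.
Qed.

(** Otherwise the integrand is [+oo] on an interval of positive length. The comparison goes through
    [ge0_le_integral_nonmeas], as the norm is not known to be measurable in time. *)
Lemma int_D2_Linfty_finite B (t u v : R) : 0 <= u -> u < v -> v <= t ->
  (int_D2_Linfty B t < +oo)%E ->
  exists2 s, u < s < v & (Lp_norm +oo (hessian_norm (B s)) < +oo)%E.
Proof.
move=> u0 uv vt fin; apply: contrapT => ns.
have : (+oo <= int_D2_Linfty B t)%E; last by rewrite leye_eq => /eqP E; rewrite E in fin.
have -> : +oo%E = (\int[@lebesgue_measure R]_(s in `[0%R, t] `&` `]u, v[) (cst +oo%E) s)%E.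
  have -> : `[0, t]%classic `&` `]u, v[%classic = `]u, v[%classic :> set R.
    by apply: setIidr => s /=; rewrite !in_itv /=; lra.
  have -> : (\int[@lebesgue_measure R]_(s in `]u, v[) (cst +oo%E) s)%E =
      (+oo * @lebesgue_measure R `]u, v[)%E by exact: integral_cst.
  rewrite lebesgue_measure_itv /= lte_fin uv -EFinD.
  by rewrite gt0_mulye// lte_fin subr_gt0.
rewrite integral_mkcondr; apply: ge0_le_integral_nonmeas => s _.
  by rewrite patchE; case: ifP => _; rewrite /= ?leey ?lexx.
rewrite patchE; case: ifPn => [|_]; last exact: Lnorm_ge0.
rewrite inE /= in_itv /= => suv; rewrite leye_eq.
apply/eqP; apply: contrapT => /eqP nB; apply: ns; exists s => //.
by rewrite ltey.
Qed.

End HessianIntegral.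

(** * Consequences of the blow-up hypothesis *)

Section BlowUp.
Context {R : realType}.
Implicit Types (B : R -> 'rV[R]_3 -> 'rV[R]_3) (H : 'rV[R]_3 -> 'rV[R]_3).

Lemma D2_blowup_unbounded (T : R) B (C : R) : 0 < T -> D2_blowup T B ->
  exists2 t, 0 <= t < T & (C%:E < int_D2_Linfty B t)%E.
Proof.
move=> T0 [_ blow].
near (T^'-) => t; exists t.
  apply/andP; split; last by near: t; exact: nbhs_left_lt.
  by near: t; exact: nbhs_left_ge.
by near: t; apply: (blow (fun y => C%:E < y)%E); exists C; split; first exact: num_real.
Unshelve. all: by end_near. Qed.

Lemma ler_sum_term (F : 'I_3 -> R) k : (forall j, 0 <= F j) -> F k <= \sum_(j < 3) F j.
Proof. by move=> F0; rewrite (bigD1 k)//= lerDl; apply: sumr_ge0. Qed.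

Lemma pd_pd_le_hessian_norm H i j k x :
  `|pd i (pd j (coord H k)) x| <= `|hessian_norm H x|.
Proof.
rewrite [leRHS]ger0_norm ?sqrtr_ge0// /hessian_norm -sqrtr_sqr ler_wsqrtr//.
have P a b c : 0 <= pd a (pd b (coord H c)) x ^+ 2 by exact: sqr_ge0.
pose F1 a b c := pd a (pd b (coord H c)) x ^+ 2.
apply: (le_trans (ler_sum_term (F1 i j) k (P i j))).
apply: (le_trans (ler_sum_term (fun b => \sum_(c < 3) F1 i b c) j _)).
  by move=> b; apply: sumr_ge0 => c _; exact: P.
apply: (ler_sum_term (fun a => \sum_(b < 3) \sum_(c < 3) F1 a b c) i) => a.
by apply: sumr_ge0 => b _; apply: sumr_ge0 => c _; exact: P.
Qed.

(** There are 27 entries, and [27 <= 6^2]. *)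
Lemma hessian_norm_le H (a : R) x : 0 <= a ->
  (forall i j k, `|pd i (pd j (coord H k)) x| <= a) -> `|hessian_norm H x| <= 6 * a.
Proof.
move=> a0 Ha; rewrite ger0_norm ?sqrtr_ge0//.
have -> : 6 * a = Num.sqrt ((6 * a) ^+ 2) by rewrite sqrtr_sqr ger0_norm// mulr_ge0.
rewrite ler_wsqrtr//.
have P i j k : pd i (pd j (coord H k)) x ^+ 2 <= a ^+ 2.
  by rewrite -[leLHS]real_normK ?num_real// lerXn2r ?nnegrE.
apply: (@le_trans _ _ (\sum_(i < 3) \sum_(j < 3) \sum_(k < 3) a ^+ 2)).
  by do 3 (apply: ler_sum => ? _).
rewrite !sumr_const !card_ord; have := sqr_ge0 a; rewrite exprMn; nra.
Qed.

Lemma D2_blowup_hessian_unbounded (T : R) B (G : R) : 0 < T -> 0 <= G -> D2_blowup T B ->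
  ~ forall t, 0 <= t < T -> forall i j k x, `|pd i (pd j (coord (B t) k)) x| <= G.
Proof.
move=> T0 G0 blow BG.
have [t /andP[t0 tT]] := D2_blowup_unbounded T B (6 * G * T) T0 blow.
apply/negP; rewrite -leNgt; apply: le_trans (_ : (6 * G * t)%:E <= _)%E; last first.
  by rewrite lee_fin ler_wpM2l ?mulr_ge0// ltW.
apply: int_D2_Linfty_le => //; first by rewrite mulr_ge0.
move=> s /andP[s0 st]; apply: Linfty_le; first by rewrite mulr_ge0.
move=> x; apply: hessian_norm_le => // i j k; apply: BG.
by rewrite s0 (le_lt_trans st).
Qed.

(** The value at [T] is positive, since otherwise the zero [a / b] would lie in [[0, T[]. An affine
    function is bounded below by the smaller of its two endpoint values. *)
Lemma affine_lower_bound (a b T : R) : 0 < T ->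
  (forall s, 0 <= s < T -> 0 < a - b * s) -> a - b * T != 0 ->
  exists2 d, 0 < d & forall s, 0 <= s < T -> d <= a - b * s.
Proof.
move=> T0 pos nz.
have a0 : 0 < a by have := pos 0; rewrite mulr0 subr0 lexx T0; apply.
have bT : 0 < a - b * T.
  rewrite lt_neqAle eq_sym nz /= leNgt; apply/negP => neg.
  have b0 : 0 < b by nra.
  have r : 0 <= a / b < T by rewrite divr_ge0 ?ltW//= ltr_pdivrMr//; nra.
  by have := pos _ r; rewrite mulrCA divff ?gt_eqF// mulr1 subrr ltxx.
exists (Num.min a (a - b * T)); first by rewrite lt_min a0.
move=> s /andP[s0 sT]; rewrite ge_min.
by have [b0|b0] := leP 0 b; apply/orP; [right|left]; nra.
Qed.

End BlowUp.

(** * The theorem *)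

Section NormalizedScaling.
Context {R : realType}.

(* The solution is its own profile at a time t0 where it is nontrivial. *)
Lemma normalized_scaling (T K t0 : R) (J : set R) (l m : R -> R)
    (H : 'rV[R]_3 -> 'rV[R]_3) (B : R -> 'rV[R]_3 -> 'rV[R]_3) :
  is_interval J -> `[0, T[ `<=` J -> J `<=` `]-oo, T[ -> 0 < t0 < T ->
  (forall t, t < T -> derivable l t 1) -> (forall t, t < T -> derivable m t 1) ->
  l t0 = 1 -> m t0 = 1 ->
  (forall s, J s -> forall x, B s x = m s *: H (l s *: x)) ->
  C2field H -> (forall i j k x, `|pd i (pd j (coord H k)) x| <= K) ->
  (\int[leb3]_p (sqnorm H (vec3 p))%:E < +oo)%E ->
  electron_mhd J B -> classical_on J B -> D2_blowup T B ->
  exists2 d, 0 < d & forall t, J t ->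
    l t = (d * (T - t)) `^ (- (2 / 7)) /\ m t = (d * (T - t)) `^ (- (3 / 7)).
Proof.
move=> iJ J0 JT /andP[t00 t0T] dl dm l0 m0 BE CH HK L2 mhd cl blow.
have T0 : 0 < T by lra.
have K0 : 0 <= K by apply: le_trans (HK 0 0 0 0).
have Jt0 : J t0 by apply: J0; rewrite /= in_itv /=; lra.
have hessB s : J s -> forall i j k x,
    pd i (pd j (coord (B s) k)) x = m s * l s * l s * pd i (pd j (coord H k)) (l s *: x).
  move=> Js i j k x.
  have -> : B s = fun x => m s *: H (l s *: x) by apply/funext => y; exact: BE.
  exact: hessian_dilation.
have JI s : 0 <= s < T -> J s by move=> sT; apply: J0; rewrite /= in_itv.
have inJ p q : J p -> J q -> forall t, p < t < q -> interior J t.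
  move=> Jp Jq t tpq.
  have : nbhs t `]p, q[%classic 
    by apply: open_nbhs_nbhs; split; [exact: itv_open | rewrite /= in_itv].
  apply: filterS => s; rewrite /= in_itv /= => /andP[/ltW ps /ltW sq].
  by apply: (iJ p q Jp Jq s); rewrite ps sq.
have nz : exists x, sqnorm H x <> 0.
  apply: contrapT => nH.
  have H0 k x : coord H k x = 0.
    have S0 : sqnorm H x = 0 by apply: contrapT => S; apply: nH; exists x.
    have := coordM_le_sqnorm H k k x.
    by rewrite S0 normr_le0 mulf_eq0 orbb => /eqP.
  have [] := D2_blowup_hessian_unbounded T B 0 T0 (lexx 0) blow.
  move=> t tT i j k x; rewrite hessB; last exact: JI.
  have -> : coord H k = fun=> 0 by apply/funext => y; exact: H0.
  have -> : pd j (fun _ : 'rV[R]_3 => 0 : R) = fun=> 0 by apply/funext => y; exact: pd_cst.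
  by rewrite pd_cst mulr0 normr0.
have profile_at t : interior J t -> l t != 0 ->
    profile_eq (l t * derive1 m t) (m t * derive1 l t) (m t ^+ 2 * l t ^+ 3) H.
  move=> it lt0.
  have tT : t < T by have := JT t (interior_subset it); rewrite /= in_itv.
  apply: (profile_eq_of_solution J B) => //; rewrite derive1E; apply: derivableP.
    exact: dl.
  exact: dm.
have it0 : interior J t0.
  by apply: (inJ 0 ((t0 + T) / 2)); [apply: JI|apply: JI|]; lra.
have e0 := profile_at t0 it0; rewrite l0 m0 !mul1r !expr1n mul1r in e0.
have {}e0 := e0 (oner_neq0 R).
have a32 : derive1 m t0 = 3 / 2 * derive1 l t0.
  have [//|H0] := energy_balance _ _ _ K H CH HK L2 e0.
  by have [x /(_ (H0 x))] := nz.
pose c := derive1 l t0 / 2.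
have rates t : interior J t -> l t != 0 ->
    l t * derive1 m t = m t ^+ 2 * l t ^+ 3 * (3 * c) /\
    m t * derive1 l t = m t ^+ 2 * l t ^+ 3 * (2 * c).
  move=> it lt0; have et := profile_at t it lt0.
  (* The equation at [t0], whose Hall coefficient is 1, is multiplied by [m^2 l^3] and subtracted
     from the equation at [t]. *)
  have lin : profile_eq (l t * derive1 m t - m t ^+ 2 * l t ^+ 3 * (3 * c))
     (m t * derive1 l t - m t ^+ 2 * l t ^+ 3 * (2 * c)) 0 H.
    move=> x k; have := et x k; have := e0 x k.
    have -> : derive1 m t0 = 3 * c by rewrite a32 /c; field.
    have -> : derive1 l t0 = 2 * c by rewrite /c; field.
    move: (coord H k x) (\sum_(i < 3) _) (coord (curl _) k x) => h S N e1 e2.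
    have : N = - (3 * c * h + 2 * c * S) by lra.
    move=> NE; rewrite NE in e2; rewrite mul0r addr0 -[RHS]e2; ring.
  have [/eqP + /eqP] := linear_profile_eq _ _ K H CH HK L2 nz lin.
  by rewrite !subr_eq0 => /eqP -> /eqP ->.
have contl t : t < T -> {for t, continuous l}.
  by move=> tT; apply: differentiable_continuous; apply/derivable1_diffP; exact: dl.
have contm t : t < T -> {for t, continuous m}.
  by move=> tT; apply: differentiable_continuous; apply/derivable1_diffP; exact: dm.
have inv t : J t -> [/\ 0 < l t, 0 < m t, m t ^+ 2 = l t ^+ 3 &
    m t * l t ^+ 2 * (1 - 7 * c * (t - t0)) = 1].
  move=> Jt.
  have tT : t < T by have := JT t Jt; rewrite /= in_itv.
  (* The ODE is solved on the segment between [t0] and [t], in either order, as [t] may precede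
     [t0]. *)
  have [Jp Jq] : J (Num.min t t0) /\ J (Num.max t t0) by case: leP.
  have qT : Num.max t t0 < T by rewrite gt_max tT.
  have rate x : Num.min t t0 < x < Num.max t t0 -> l x != 0 -> m x != 0 ->
      derive1 l x = 2 * c * (m x * l x ^+ 3) /\ derive1 m x = 3 * c * (m x ^+ 2 * l x ^+ 2).
    move=> xpq lx mx; have [r1 r2] := rates x (inJ _ _ Jp Jq x xpq) lx.
    split; first by apply: (mulfI mx); rewrite r2; ring.
    by apply: (mulfI lx); rewrite r1; ring.
  apply: (@scaling_ode_invariants R l m c t0 (Num.min t t0) (Num.max t t0)) => //.
  - by move=> x /andP[_ xq]; apply: contl; exact: le_lt_trans qT.
  - by move=> x /andP[_ xq]; apply: contm; exact: le_lt_trans qT.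
  - move=> x xpq lx mx; have [<- _] := rate x xpq lx mx.
    rewrite derive1E; apply: derivableP; apply: dl.
    by move: xpq => /andP[_ xq]; exact: lt_trans qT.
  - move=> x xpq lx mx; have [_ <-] := rate x xpq lx mx.
    rewrite derive1E; apply: derivableP; apply: dm.
    by move: xpq => /andP[_ xq]; exact: lt_trans qT.
  - by rewrite ge_min le_max !lexx !orbT.
  - by rewrite ge_min le_max !lexx.
have pos s : J s -> 0 < (1 + 7 * c * t0) - 7 * c * s.
  move=> /inv[ls ms _ e1].
  have g0 : 0 < m s * l s ^+ 2 by rewrite mulr_gt0// exprn_gt0.
  have -> : (1 + 7 * c * t0) - 7 * c * s = 1 - 7 * c * (s - t0) by ring.
  by rewrite -(pmulr_rgt0 _ g0) e1.
(* Otherwise the affine factor stays above some [d > 0], so [m l^2] is at most [1 / d] and the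
   Hessian of [B] is bounded by [K / d] up to [T]. *)
have DT : (1 + 7 * c * t0) - 7 * c * T = 0.
  apply/eqP; apply: contrapT => /negP nT.
  have [d d0 dle] := affine_lower_bound _ _ T T0 (fun s sT => pos s (JI s sT)) nT.
  apply: (D2_blowup_hessian_unbounded T B (d^-1 * K) T0 _ blow).
    by rewrite mulr_ge0// invr_ge0 ltW.
  move=> s sT i j k x; rewrite hessB; last exact: JI.
  have [ls ms _ e1] := inv s (JI s sT).
  have g0 : 0 < m s * l s ^+ 2 by rewrite mulr_gt0// exprn_gt0.
  have -> : m s * l s * l s = m s * l s ^+ 2 by ring.
  rewrite normrM (gtr0_norm g0); apply: ler_pM => //; first exact: ltW.
  rewrite -[leRHS]mul1r ler_pdivlMr// -e1 ler_pM2l//.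
  by have := dle s sT; lra.
have c0 : 0 < 7 * c.
  have : 7 * c * (T - t0) = 1 by lra.
  have Tt : 0 < T - t0 by lra.
  by move=> h; rewrite -(pmulr_lgt0 _ Tt) h.
exists (7 * c) => // t Jt; have [lt mt ml e1] := inv t Jt.
have tT : t < T by have := JT t Jt; rewrite /= in_itv.
apply: power_form => //; first by rewrite mulr_gt0// subr_gt0.
have -> : 7 * c * (T - t) = 1 - 7 * c * (t - t0) by lra.
exact: e1.
Qed.

End NormalizedScaling.

(** Where [lambda] or [mu] vanishes, [B t] is constant in space. If this happened on all of [[0,
    T[], the Hessian would be zero, against the blow-up. *)
Lemma nontrivial_time (R : realType) (T : R) (lambda mu : R -> R) (J : set R)
    (H : 'rV[R]_3 -> 'rV[R]_3) (B : R -> 'rV[R]_3 -> 'rV[R]_3) :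
  0 < T -> (forall t, 0 <= t < T -> J t) ->
  {for 0, continuous lambda} -> {for 0, continuous mu} ->
  pseudo_self_similar J lambda mu H B -> D2_blowup T B ->
  exists2 s, 0 < s < T & lambda s != 0 /\ mu s != 0.
Proof.
move=> T0 JI cl cm BH blow; apply: contrapT => ns.
have z s : 0 <= s < T -> lambda s * mu s = 0.
  move=> /andP[s0 sT].
  have [s00|sn0] := eqVneq s 0; last first.
    apply/eqP; apply: contrapT => /negP; rewrite mulf_eq0 negb_or => /andP[ls ms].
    by apply: ns; exists s => //; rewrite sT lt_neqAle eq_sym sn0 s0.
  (* Time 0 is not covered by the assumption on []0, T[] and is reached by continuity of the
     product. *)
  rewrite s00; apply/eqP; apply: contrapT => /negP n0.
  have clm : {for 0, continuous (fun s => lambda s * mu s)} by exact: continuousM.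
  have dn : 0 < `|lambda 0 * mu 0| by rewrite normr_gt0.
  move/cvgrPdist_lt: clm => /(_ _ dn) /nbhs_ballP[e /= e0 be].
  pose r := Num.min (e / 2) (T / 2).
  have [r0 rT re] : [/\ 0 < r, r < T & r < e].
    rewrite /r lt_min !gt_min !divr_gt0//=.
    by split=> //; apply/orP; [right|left]; lra.
  have : ball 0 e r by rewrite /ball /= sub0r normrN gtr0_norm.
  move=> /be; have -> : lambda r * mu r = 0.
    apply/eqP; apply: contrapT => /negP; rewrite mulf_eq0 negb_or => /andP[lr mr].
    by apply: ns; exists r => //; rewrite r0.
  by rewrite subr0 ltxx.
apply: (D2_blowup_hessian_unbounded T B 0 T0 (lexx 0) blow) => t tT i j k x.
have [v Bv] : exists v, B t = fun=> v.
  have /eqP := z t tT; rewrite mulf_eq0 => /orP[/eqP l0|/eqP m0].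
    by exists (mu t *: H 0); apply/funext => y; rewrite (BH t (JI t tT)) l0 scale0r.
  by exists 0; apply/funext => y; rewrite (BH t (JI t tT)) m0 scale0r.
have -> : coord (B t) k = fun=> v 0 k by rewrite Bv.
have -> : pd j (fun _ : 'rV[R]_3 => v 0 k) = fun=> 0.
  by apply/funext => y; exact: pd_cst.
by rewrite pd_cst normr0.
Qed.

Theorem theorem1p4 (R : realType) (T : R) (hT : 0 < T)
  (lambda mu : R -> R)
  (hlambda : C1_on `]-oo, T[ lambda) (hmu : C1_on `]-oo, T[ mu)
  (J : set R) (hJ : is_interval J)
  (hJ0 : `[0, T[ `<=` J) (hJT : J `<=` `]-oo, T[)
  (hns : ~ exists a1 a2 : R, forall t, J t ->
           lambda t = a1 * (T - t) `^ (- (2 / 7)) /\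
           mu t = a2 * (T - t) `^ (- (3 / 7))) :
  ~ exists B : R -> 'rV[R]_3 -> 'rV[R]_3,
      (exists H : 'rV[R]_3 -> 'rV[R]_3, pseudo_self_similar J lambda mu H B) /\
      electron_mhd J B /\
      classical_on J B /\
      bounded_energy T B /\
      D2_blowup T B.
Proof.
move=> [B [[H BH] [mhd [cl [en blow]]]]].
have JI t : 0 <= t < T -> J t by move=> tT; apply: hJ0; rewrite /= in_itv.
have dl t : t < T -> derivable lambda t 1.
  by move=> tT; apply: hlambda.1; rewrite /= in_itv.
have dm t : t < T -> derivable mu t 1.
  by move=> tT; apply: hmu.1; rewrite /= in_itv.
have contl t : t < T -> {for t, continuous lambda}.
  by move=> tT; apply: differentiable_continuous; apply/derivable1_diffP; exact: dl.
have contm t : t < T -> {for t, continuous mu}.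
  by move=> tT; apply: differentiable_continuous; apply/derivable1_diffP; exact: dm.
have [s /andP[s0 sT] [ls ms]] := nontrivial_time _ _ _ _ _ _ _ hT JI
  (contl 0 hT) (contm 0 hT) BH blow.
have [u [v [u0 uv vT nzuv]]] : exists u v, [/\ 0 <= u, u < v, v < T &
    forall t, u < t < v -> lambda t != 0 /\ mu t != 0].
  have : \forall t \near s, lambda t != 0 /\ mu t != 0.
    near=> t; split; near: t.
      exact: cvgr_neq0 (contl s sT) ls.
    exact: cvgr_neq0 (contm s sT) ms.
  move=> /nbhs_ballP[e /= e0 be].
  (* The midpoint [(s + T) / 2] keeps [v] strictly below [T], where the Hessian integral is still
     finite. *)
  exists (Num.max 0 (s - e)), (Num.min (s + e) ((s + T) / 2)).
  rewrite le_max lexx gt_max !lt_min !gt_min; split => //.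
  - by apply/andP; split; apply/andP; split; lra.
  - by apply/orP; right; lra.
  - move=> t; rewrite gt_max lt_min => /andP[/andP[t0 t1] /andP[t2 t3]].
    by apply: be; rewrite /ball /= ltr_distlC; lra.
have [s1 /andP[us1 s1v] Hs1] : exists2 s, u < s < v & (Lp_norm +oo (hessian_norm (B s)) < +oo)%E.
  by apply: (int_D2_Linfty_finite B v u v) => //; apply: blow.1; lra.
have [t0 /andP[ut0 t0v] Et0] := bounded_energy_finite T B u v en u0 uv (ltW vT).
have [ls1 ms1] := nzuv s1 (introT andP (conj us1 s1v)).
have [lt0 mt0] := nzuv t0 (introT andP (conj ut0 t0v)).
have Js1 : J s1 by apply: JI; lra.
have Jt0 : J t0 by apply: JI; lra.
(* This eliminates [H]: every slice is a dilate of the slice at [q], which inherits the regularity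
   of [B]. *)
have BE r q : J r -> J q -> lambda q != 0 -> mu q != 0 ->
    forall x, B r x = (mu r / mu q) *: B q ((lambda r / lambda q) *: x).
  move=> Jr Jq lq mq x; rewrite (BH r Jr) (BH q Jq) !scalerA divfK//.
  by rewrite [lambda q * _]mulrC divfK.
have C1 := classical_C2field J B s1 cl Js1.
have [K K0 HK] := Linfty_bounded _ Hs1.
(* The Hessian bound found at [s1] is carried by dilation to [t0], the time of finite energy. *)
pose K1 := `|mu t0 / mu s1 * (lambda t0 / lambda s1) * (lambda t0 / lambda s1)| * K.
have HK1 i j k x : `|pd i (pd j (coord (B t0) k)) x| <= K1.
  have -> : B t0 = fun x => (mu t0 / mu s1) *: B s1 ((lambda t0 / lambda s1) *: x).
    by apply/funext => y; exact: BE.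
  rewrite (hessian_dilation (B s1) C1) normrM ler_wpM2l//.
  apply: HK; first by apply: C1fun_continuous_pd; have [_ +] := C1 k; apply.
  by move=> y; exact: pd_pd_le_hessian_norm.
have t0T : 0 < t0 < T by lra.
have [] := @normalized_scaling R T K1 t0 J (fun t => lambda t / lambda t0) (fun t => mu t / mu t0)
  (B t0) B hJ hJ0 hJT t0T _ _ _ _ _ (classical_C2field J B t0 cl Jt0) HK1
  (sqnorm_integral_lty _ Et0) mhd cl blow.
- by move=> t tT; apply: derivableM; [exact: dl | exact: derivable_cst].
- by move=> t tT; apply: derivableM; [exact: dm | exact: derivable_cst].
- by rewrite divff.
- by rewrite divff.
- by move=> r Jr x; exact: BE.
move=> d d0 rates; apply: hns.
exists (lambda t0 * d `^ (- (2 / 7))), (mu t0 * d `^ (- (3 / 7))) => t Jt.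
have tT : t < T by have := hJT t Jt; rewrite /= in_itv.
have [lt mt] := rates t Jt.
rewrite -!mulrA -!powRM ?subr_ge0 ?(ltW d0) ?(ltW tT)// -lt -mt.
by split; field.
Unshelve. all: by end_near. Qed.
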